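(* Let $k$ be a differential field of characteristic zero with derivations $\Delta=\{\delta_1,\dots,\delta_m\}$, $R=k\{y_1,\ldots,y_l\}$, and fix an orderly ranking. Let $I$ be a radical differential ideal of $R$ satisfying the property of consistency, i.e. there is a Kolchin characteristic set $\mathbb{C}\subset I$ of $I$ with $1\notin[\mathbb{C}]:H_{\mathbb{C}}^\infty$. Let $I=\bigcap_{i=1}^n[\mathbb{C}_i]:H_{\mathbb{C}_i}^\infty$ be a characteristic decomposition of $I$ with respect to this ranking, $\mathbb{C}_i=C_i^1,\ldots,C_i^{p_i}$, and let $h$ be the maximal order of a derivative appearing in the elements of $\mathbb{C}_1,\ldots,\mathbb{C}_n$. In the polynomial ring $R_h=k[\theta y_j:\ 1\le j\le l,\ \theta\in\Theta,\ \operatorname{ord}\theta\le h]$ consider $$I'=\bigcap_{i=1}^n\big(\theta C_i^j:\ 1\le j\le p_i,\ \theta\in\Theta,\ \operatorname{ord}(\theta u_{C_i^j})\le h\big):H_{\mathbb{C}_i}^\infty.$$ Let $\mathbb{C}'$ be an algebraic characteristic set of $I'$ with respect to the ordering of the variables of $R_h$ induced by the ranking. Then the differentially autoreduced subset of $\mathbb{C}'$ of lowest rank is a Kolchin characteristic set of $I$ with respect to the orderly ranking.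
   Context: $\Theta$ is the free commutative monoid of operators $\theta=\delta_1^{k_1}\cdots\delta_m^{k_m}$, $\operatorname{ord}\theta=\sum k_i$; $R$ is the polynomial ring over $k$ in the derivatives $\theta y_j$, the order of $\theta y_j$ being $\operatorname{ord}\theta$. A ranking is a total order on $\{\theta y_j\}$ with $\theta u\ge u$ and $u\ge v\Rightarrow\theta u\ge\theta v$; orderly if $\operatorname{ord}u>\operatorname{ord}v\Rightarrow u>v$. For $f\notin k$: leader $u_f$ = highest ranked derivative in $f$, initial $I_f$ = leading coefficient in $u_f$, separant $S_f=\partial f/\partial u_f$. $f$ is reduced w.r.t. $g$ if no proper derivative of $u_g$ appears in $f$ and $\deg_{u_g}f<\deg_{u_g}g$. A (differentially) autoreduced set is a set disjoint from $k$ each of whose elements is reduced w.r.t. the others; elements are listed in increasing rank ($f<g$ if $u_f<u_g$, or same leader and smaller degree), autoreduced sets compared lexicographically with a proper extension having lower rank. A (Kolchin) characteristic set of a differential ideal is an autoreduced subset of lowest rank. Algebraic notions (algebraically autoreduced set, algebraic characteristic set of a polynomial ideal) are the same with ''reduced'' meaning only $\deg_{u_g}f<\deg_{u_g}g$. $H_{\mathbb{A}}$ is the product of all initials and separants of elements of $\mathbb{A}$; $J:S^\infty=\{a:\exists s\in S^\infty, sa\in J\}$ with $S^\infty$ the multiplicative set generated by $S$; $[F]$ is the differential ideal generated by $F$. A radical differential ideal $J$ is characterizable if it has a Kolchin characteristic set $\mathbb{A}$ with $J=[\mathbb{A}]:H_{\mathbb{A}}^\infty$. A characteristic decomposition of a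 radical differential ideal $I$ is a representation $I=\bigcap_i[\mathbb{C}_i]:H_{\mathbb{C}_i}^\infty$ where each $[\mathbb{C}_i]:H_{\mathbb{C}_i}^\infty$ is characterizable with Kolchin characteristic set $\mathbb{C}_i$. *)

(* Defs.v *)
From mathcomp Require Import all_boot all_algebra finmap.
From mathcomp.multinomials Require Import monalg.

Set Implicit Arguments.
Unset Strict Implicit.
Unset Printing Implicit Defensive.

Import GRing.Theory.
Local Open Scope ring_scope.

(* theta = delta_1^{k_1} ... delta_m^{k_m} is its exponent vector.     *)
Notation Theta m := {ffun 'I_m -> nat}.
(* the derivative theta y_j is the pair (j, theta) *)
Notation Der m l := ('I_l * Theta m)%type.
(* R = k{y_1,...,y_l} : polynomial ring over k in all theta y_j *)
Notation DPoly k m l := {malg k[{cmonom Der m l}]}.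

Definition ordT m (t : Theta m) : nat := (\sum_(i < m) t i)%N.
Definition ordD m l (u : Der m l) : nat := ordT u.2.

Definition thetaM m (t t' : Theta m) : Theta m := [ffun i => (t i + t' i)%N].
Definition thetaD m l (t : Theta m) (u : Der m l) : Der m l := (u.1, thetaM t u.2).
Definition deltaT m (i : 'I_m) : Theta m := [ffun j => nat_of_bool (j == i)].
Definition proper_derivative m l (u v : Der m l) : bool :=
  [&& u.1 == v.1, [forall i, (u.2 i <= v.2 i)%N] & u != v].

Definition is_derivation (k : fieldType) (d : k -> k) : Prop :=
  (forall a b, d (a + b) = d a + d b) /\ (forall a b, d (a * b) = d a * b + a * d b).

Definition diff_field_char0 (k : fieldType) m (delta : 'I_m -> k -> k) : Prop :=
  [pchar k] =i pred0 /\
  (forall i, is_derivation (delta i)) /\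
  (forall i j a, delta i (delta j a) = delta j (delta i a)).

Section DiffPoly.
Variables (k : fieldType) (m l : nat) (delta : 'I_m -> k -> k).

Local Notation R := (DPoly k m l).

Definition dvar (u : Der m l) : R := << ucm u >>.

(* extension of delta_i to R: delta_i(theta y_j) = (delta_i theta) y_j *)
Definition dderiv (i : 'I_m) (p : R) : R :=
  \sum_(M <- msupp p)
     (delta i (p@_M) *: << M >> +
      p@_M *: \sum_(x <- finsupp M)
                 ((M x)%:R *: (<< divcm M (ucm x) >> * dvar (thetaD (deltaT i) x)))).

Definition dapply (t : Theta m) (p : R) : R :=
  foldr (fun i q => iter (t i) (dderiv i) q) p (enum 'I_m).

Definition vars (p : R) : seq (Der m l) :=
  undup (flatten (map (fun M : {cmonom Der m l} => (finsupp M : seq (Der m l))) (msupp p))).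

Definition notin_k (p : R) : bool := vars p != [::].

Definition degv (u : Der m l) (p : R) : nat := (\max_(M <- msupp p) M u)%N.

Definition lcoefv (u : Der m l) (p : R) : R :=
  \sum_(M <- msupp p | M u == degv u p)
     p@_M *: << divcm M (expcmn (ucm u) (M u)) >>.

Definition pderivv (u : Der m l) (p : R) : R :=
  \sum_(M <- msupp p) (p@_M * (M u)%:R) *: << divcm M (ucm u) >>.

Variable rk : rel (Der m l).   (* rk u v  <->  u <= v *)

Definition is_ranking : Prop :=
  [/\ [/\ reflexive rk, antisymmetric rk, transitive rk & total rk],
      (forall t u, rk u (thetaD t u)) &
      (forall t u v, rk u v -> rk (thetaD t u) (thetaD t v))].

Definition is_orderly : Prop :=
  forall u v, (ordD v < ordD u)%N -> rk v u && (u != v).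

Definition leader (p : R) : option (Der m l) :=
  foldr (fun v acc => if acc is Some a then Some (if rk a v then v else a)
                      else Some v) None (vars p).

Definition initial (p : R) : R :=
  if leader p is Some u then lcoefv u p else 1.

Definition separant (p : R) : R :=
  if leader p is Some u then pderivv u p else 1.

Definition rank_lt (f g : R) : bool :=
  match leader f, leader g with
  | Some uf, Some ug =>
      (rk uf ug && (uf != ug)) || ((uf == ug) && (degv uf f < degv ug g)%N)
  | _, _ => false
  end.

Definition rank_eq (f g : R) : bool :=
  match leader f, leader g with
  | Some uf, Some ug => (uf == ug) && (degv uf f == degv ug g)
  | None, None => true
  | _, _ => false
  end.

Definition dreduced (f g : R) : bool :=
  if leader g is Some ug then
    all (fun v => ~~ proper_derivative ug v) (vars f) && (degv ug f < degv ug g)%N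
  else true.

Definition areduced (f g : R) : bool :=
  if leader g is Some ug then (degv ug f < degv ug g)%N else true.

Definition autoreduced_wrt (red : R -> R -> bool) (A : seq R) : Prop :=
  [/\ all notin_k A,
      sorted rank_lt A &
      (forall i j, (i < size A)%N -> (j < size A)%N -> i != j ->
         red (nth 0 A i) (nth 0 A j))].

Definition dautoreduced := autoreduced_wrt dreduced.
Definition aautoreduced := autoreduced_wrt areduced.

Fixpoint aut_lt (A B : seq R) : bool :=
  match A, B with
  | a :: A', b :: B' => rank_lt a b || (rank_eq a b && aut_lt A' B')
  | _ :: _, [::] => true
  | [::], _ => false
  end.

Definition HA (A : seq R) : R := \prod_(f <- A) (initial f * separant f).

Definition subsetP (A : seq R) (J : R -> Prop) : Prop := forall f, f \in A -> J f.

Definition dideal (F : seq R) (p : R) : Prop :=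
  exists s : seq (R * Theta m * R),
    (forall t, t \in s -> t.2 \in F) /\
    p = \sum_(t <- s) t.1.1 * dapply t.1.2 t.2.

Definition saturate (J : R -> Prop) (H : R) (p : R) : Prop :=
  exists n : nat, J (H ^+ n * p).

Definition is_radical_dideal (J : R -> Prop) : Prop :=
  [/\ J 0,
      (forall a b, J a -> J b -> J (a + b)),
      (forall a b, J b -> J (a * b)),
      (forall i a, J a -> J (dderiv i a)) &
      (forall a n, J (a ^+ n) -> J a)].

Definition kolchin_charset (J : R -> Prop) (A : seq R) : Prop :=
  [/\ dautoreduced A, subsetP A J &
      forall B, dautoreduced B -> subsetP B J -> ~~ aut_lt B A].

Definition characterizable_with (J : R -> Prop) (A : seq R) : Prop :=
  [/\ is_radical_dideal J, kolchin_charset J A &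
      forall p, J p <-> saturate (dideal A) (HA A) p].

Definition char_decomposition (I : R -> Prop) (n : nat) (C : 'I_n -> seq R) : Prop :=
  (forall p, I p <-> forall i, saturate (dideal (C i)) (HA (C i)) p) /\
  (forall i, characterizable_with (saturate (dideal (C i)) (HA (C i))) (C i)).

(* The truncated polynomial ring R_h, seen as the subring of R of the
   polynomials involving only derivatives of order <= h. *)
Definition in_Rh (h : nat) (p : R) : bool := all (fun v => ordD v <= h)%N (vars p).

Definition max_order (n : nat) (C : 'I_n -> seq R) : nat :=
  (\max_(i < n) \max_(f <- C i) \max_(v <- vars f) ordD v)%N.

Definition ideal_Rh (h : nat) (G : R -> Prop) (p : R) : Prop :=
  exists s : seq (R * R),
    (forall t, t \in s -> in_Rh h t.1 /\ G t.2) /\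
    p = \sum_(t <- s) t.1 * t.2.

Definition trunc_gens (h : nat) (A : seq R) (g : R) : Prop :=
  exists (f : R) (t : Theta m), [/\ f \in A,
    (if leader f is Some u then ordD (thetaD t u) <= h else false)%N &
    g = dapply t f].

Definition Iprime (h n : nat) (C : 'I_n -> seq R) (p : R) : Prop :=
  in_Rh h p /\
  forall i, exists e : nat, ideal_Rh h (trunc_gens h (C i)) (HA (C i) ^+ e * p).

Definition alg_charset (J : R -> Prop) (A : seq R) : Prop :=
  [/\ aautoreduced A, subsetP A J &
      forall B, aautoreduced B -> subsetP B J -> ~~ aut_lt B A].

Definition lowest_dautoreduced_subset (A B : seq R) : Prop :=
  [/\ dautoreduced B, {subset B <= A} &
      forall B', dautoreduced B' -> {subset B' <= A} -> ~~ aut_lt B' B].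

End DiffPoly.

(* Main.v *)
(* An orderly ranking is isomorphic to an initial segment of the natural numbers
   (finitely many derivatives lie below a given one), which turns it into an index
   [nu] for inductions.  For an autoreduced set A, let G_w be an element of A with
   leader w or a derivative of one; a proper derivative is linear in its leader,
   with the separant as coefficient.  Pseudo-reduction by the G_w shows that every
   element of an ideal J without 1 having characteristic set A is, up to a factor
   dividing a power of H_A, a combination of the G_w.

   Three facts give the theorem.

   1. No J_i = [C_i] : H^oo contains 1: a characteristic set of the unit ideal
      consists of equations a y_j + b with a, b in k, which have a common
      differential zero over k.  Hence I' is the intersection of I and R_h.

   2. The leaders of the given characteristic set C0 of I have order at most h.
      Suppose that c in C0 has leader u of larger order.  If u is not a derivative
      of a leader of C_i, then the reduction of c to zero modulo C_i, differentiated
      with respect to u, puts the separant of c into J_i.  Otherwise u is a proper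
      derivative of the leader v of some g in C_i, and v is not a derivative of a
      leader of C0, so that some derivation D kills all G_w and satisfies D v = s and
      D x = 0 for x < v, where s divides a power of H_C0.  Applying D shows that
      p g in I : H_C0^oo implies p S_g in I : H_C0^oo, and S_g can be cancelled
      modulo J_i.  Treating these indices i one at a time yields that 1 lies in
      I : H_C0^oo, against consistency.

   3. For v of order at most h, C' contains an element with leader v if and only if
      v is a derivative of a leader of C0, and then its degree in v is that of G_v.
      This follows by induction on v: the elements of C' below v and the G_w with
      w < v have the same leaders and degrees, hence define the same notion of being
      reduced, and both sets are minimal.

   So the elements of C' whose leaders are leaders of C0 form a differentially
   autoreduced set of the same rank as C0. *)
Require Import Defs.
From HB Require Import structures.
From Stdlib Require Import Classical.
From mathcomp Require Import all_boot all_algebra ring zify finmap.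
From mathcomp.multinomials Require Import monalg.

Set Implicit Arguments.
Unset Strict Implicit.
Unset Printing Implicit Defensive.

Import GRing.Theory.
Local Open Scope ring_scope.

(** * Degrees and partial derivatives *)

Section Monomials.
Variables (k : fieldType) (K : conomType).
Local Notation R := {malg k[K]}.

Lemma malg_ind (P : R -> Prop) :
  P 0 -> (forall p q, P p -> P q -> P (p + q)) ->
  (forall c M, P << c *g M >>) -> forall p, P p.
Proof. by move=> P0 PD PU p; rewrite [p]monalgE; apply: big_ind. Qed.

Lemma monom_scale c (M : K) : << c *g M >> = c *: << M >> :> R.
Proof.
apply/malgP => N; rewrite mcoeffZ !mcoeffU.
by case: (M == N); rewrite ?mulr1n ?mulr0n ?mulr1 ?mulr0.
Qed.

Lemma monomM (M N : K) : << (mmul M N) >> = << M >> * << N >> :> R.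
Proof. by rewrite malgM_def fgmulUU mulr1. Qed.

Lemma monomMM c c' (M N : K) :
  << c *g M >> * << c' *g N >> = << c * c' *g mmul M N >> :> R.
Proof. by rewrite malgM_def fgmulUU. Qed.

End Monomials.

Section Algebra.
Variables (k : fieldType) (m l : nat).
Local Notation T := (Der m l).
Local Notation R := (DPoly k m l).
Implicit Types (p q r : R) (x y u w : T) (M N : {cmonom T}).

Lemma divcm_ucmM x M N : (0 < M x)%N ->
  divcm (mmul M N) (ucm x) = mmul (divcm M (ucm x)) N.
Proof.
move=> Mx; apply/eqP/cmP => i.
rewrite cmM !divcmE cmM ucmE; case: eqP => [<-|_]; last by rewrite !subn0.
by rewrite addnBAC.
Qed.

Lemma expcmnE x n y : expcmn (ucm x) n y = (n * (x == y))%N.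
Proof.
have H : expcmn (ucm x) n = iter n (mulcm (ucm x)) (onecm _).
  case: n => [|n] //; rewrite /expcmn /iterop iteriS.
  elim: n => [|n IH]; first by rewrite /= mulcm0.
  by rewrite iteriS IH.
rewrite H; elim: n {H} => [|n IH]; first by rewrite /= onecmE.
by rewrite iterS mulcmE IH ucmE mulSn.
Qed.

Lemma degv_leP x p d :
  reflect (forall M, M \in msupp p -> (M x <= d)%N) (degv x p <= d)%N.
Proof.
apply: (iffP (bigmax_leqP_seq _ _ _ _)) => H M; first by move/H; apply.
by move=> /H.
Qed.

Lemma degv_ge x p M : M \in msupp p -> (M x <= degv x p)%N.
Proof. by move: M; apply/degv_leP. Qed.

Lemma mem_vars x p : (x \in vars p) = (degv x p != 0)%N.
Proof.
rewrite mem_undup -lt0n; apply/flattenP/idP => [[_ /mapP[M Mp ->]] xM|].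
  by apply: leq_trans (degv_ge x Mp); rewrite lt0n cmE_neq0.
case: (posnP (degv x p)) => // dx _.
have [M Mp Mx] : exists2 M, M \in msupp p & (0 < M x)%N.
  case: (boolP (has (fun M : {cmonom T} => 0 < M x)%N (msupp p))).
    by move/hasP.
  move/hasPn => H; move: dx; rewrite ltnNge; case/negP.
  by apply/degv_leP => M /H; rewrite -leqNgt.
exists (finsupp M : seq T); first by apply/mapP; exists M.
by rewrite -cmE_neq0 -lt0n.
Qed.

Lemma degv_vars x p : x \notin vars p -> degv x p = 0%N.
Proof. by rewrite mem_vars negbK => /eqP. Qed.

Lemma degv0 x : degv x (0 : R) = 0%N.
Proof. by rewrite /degv msupp0 big_seq_fset0. Qed.

Lemma degvD x p q d : (degv x p <= d)%N -> (degv x q <= d)%N -> (degv x (p + q) <= d)%N.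
Proof.
move=> /degv_leP Hp /degv_leP Hq; apply/degv_leP => M.
by move/(fsubsetP (msuppD_le p q)); rewrite in_fsetU => /orP[/Hp|/Hq].
Qed.

Lemma degvN x p : degv x (- p) = degv x p.
Proof. by rewrite /degv msuppN. Qed.

Lemma degvM x p q : (degv x (p * q) <= degv x p + degv x q)%N.
Proof.
apply/degv_leP => M /(fsubsetP (msuppM_incl p q)) /imfset2P [M1 M1p [M2 M2q ->]].
by rewrite cmM leq_add ?degv_ge.
Qed.

Lemma degvM_le x p q d e : (degv x p <= d)%N -> (degv x q <= e)%N ->
  (degv x (p * q) <= d + e)%N.
Proof. by move=> Hp Hq; apply: leq_trans (degvM x p q) (leq_add Hp Hq). Qed.

Lemma degvZ x c p : (degv x (c *: p) <= degv x p)%N.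
Proof. by apply/degv_leP => M /(fsubsetP (msuppZ_le c p)); apply: degv_ge. Qed.

Lemma degv_monom x M : degv x (<< M >> : R) = M x.
Proof. by rewrite /degv msuppU1 big_seq_fset1. Qed.

Lemma degv_dvar x u : degv x (dvar k u) = (u == x).
Proof. by rewrite degv_monom ucmE. Qed.

Lemma degv1 x : degv x (1 : R) = 0%N.
Proof. by rewrite degv_monom cm1. Qed.

Lemma degvC x c : degv x (c%:MP : R) = 0%N.
Proof.
apply/eqP; rewrite -leqn0; apply/degv_leP => M /(fsubsetP (@msuppC_le _ _ c)).
by rewrite in_fset1 => /eqP ->; rewrite cm1.
Qed.

Lemma degv_sum (J : eqType) (s : seq J) (F : J -> R) x d :
  (forall t, t \in s -> (degv x (F t) <= d)%N) -> (degv x (\sum_(t <- s) F t) <= d)%N.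
Proof.
move=> H; rewrite big_seq; apply: (big_ind (fun q : R => (degv x q <= d)%N)) => //; first by rewrite degv0.
by move=> *; apply: degvD.
Qed.

Lemma constP p : reflect (exists c, p = c%:MP) (vars p == [::]).
Proof.
apply: (iffP eqP) => [pE|[c ->]]; last first.
  by case E: (vars _) => [//|x s]; have := mem_vars x c%:MP; rewrite E degvC inE eqxx.
exists p@_mone; rewrite {1}[p]monalgE big_seq.
rewrite (eq_bigr (fun M => << p@_M *+ (M == mone) *g mone >>)); last first.
  move=> M Mp; have ->: M = mone; last by rewrite eqxx mulr1n.
  apply/eqP/cmP => x; rewrite cm1; apply/eqP; rewrite -leqn0.
  by apply: leq_trans (degv_ge x Mp) _; rewrite degv_vars // pE.
rewrite -big_seq; case: (boolP (mone \in msupp p)) => H1.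
  rewrite (big_fsetD1 mone) //= eqxx mulr1n big1_fset ?addr0 // => M.
  by rewrite in_fsetD1 => /andP[/negbTE -> _] _; rewrite mulr0n monalgU0.
rewrite (mcoeff_outdom H1) monalgU0 big1_fset // => M Mp _.
by case: eqP => [E|]; [rewrite -E Mp in H1 | rewrite monalgU0].
Qed.

Lemma pderivvE x p : pderivv x p =
  mmap malgC (fun M => (M x)%:R *: << divcm M (ucm x) >>) p.
Proof.
rewrite mmapE; apply: eq_bigr => M _.
by rewrite mul_malgC scalerA.
Qed.

Lemma pderivvD x p q : pderivv x (p + q) = pderivv x p + pderivv x q.
Proof. by rewrite !pderivvE mmapD. Qed.

Lemma pderivv0 x : pderivv x (0 : R) = 0.
Proof. by rewrite pderivvE mmap0. Qed.

Lemma pderivvU x (c : k) M :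
  pderivv x (<< c *g M >> : R) = (c * (M x)%:R) *: (<< divcm M (ucm x) >> : R).
Proof. by rewrite pderivvE mmapU mul_malgC scalerA. Qed.

Lemma leibniz_addl (S : comRingType) (D : S -> S) (p1 p2 q : S) :
  (forall a b : S, D (a + b) = D a + D b) ->
  D (p1 * q) = D p1 * q + p1 * D q -> D (p2 * q) = D p2 * q + p2 * D q ->
  D ((p1 + p2) * q) = D (p1 + p2) * q + (p1 + p2) * D q.
Proof. by move=> DD H1 H2; rewrite mulrDl !DD H1 H2 !mulrDl addrACA. Qed.

(** The product rule for two monomials in which the variable has exponents [a] and [b]. Division by
    a variable is truncated, so each factorisation of [U] needs a positive exponent; for exponent 0
    the coefficient vanishes. *)
Lemma leibniz_scale (S : comAlgType k) (c c' : k) (a b : nat) (U A B A1 B1 : S) :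
  ((0 < a)%N -> U = A1 * B) -> ((0 < b)%N -> U = B1 * A) ->
  (c * c' * (a + b)%:R) *: U =
  ((c * a%:R) *: A1) * (c' *: B) + (c *: A) * ((c' * b%:R) *: B1).
Proof.
move=> HA HB; rewrite -!scalerAl -!scalerAr !scalerA natrD mulrDr scalerDl.
congr (_ + _).
  rewrite [c * a%:R * c']mulrAC.
  by case: (posnP a) => [->|/HA ->]; rewrite ?mulr0 ?scale0r.
rewrite [c * (c' * _)]mulrA.
by case: (posnP b) => [->|/HB ->]; [rewrite ?mulr0 !scale0r | rewrite [B1 * A]mulrC].
Qed.

Lemma pderivvM_monom x (c c' : k) M N (p := << c *g M >> : R) (q := << c' *g N >> : R) :
  pderivv x (p * q) = pderivv x p * q + p * pderivv x q.
Proof.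
etransitivity; first exact: (congr1 (pderivv x) (monomMM c c' M N)).
etransitivity; first exact: pderivvU.
symmetry; etransitivity.
  apply: (congr2 +%R).
    exact: (congr2 *%R (pderivvU x c M) (monom_scale c' N)).
  exact: (congr2 *%R (monom_scale c M) (pderivvU x c' N)).
rewrite cmM; symmetry; apply: leibniz_scale => H.
  by rewrite divcm_ucmM //; apply: monomM.
by rewrite mulmC divcm_ucmM //; apply: monomM.
Qed.

Lemma leibniz_sym (S : comRingType) (D : S -> S) (p q : S) :
  D (p * q) = D p * q + p * D q -> D (q * p) = D q * p + q * D p.
Proof. by move=> H; rewrite mulrC H addrC; congr (_ + _); rewrite mulrC. Qed.

Lemma leibniz_zero (S : comRingType) (D : S -> S) (q : S) :
  D 0 = 0 -> D (0 * q) = D 0 * q + 0 * D q.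
Proof. by move=> D0; rewrite !mul0r D0 mul0r addr0. Qed.

Lemma pderivvM x p q : pderivv x (p * q) = pderivv x p * q + p * pderivv x q.
Proof.
elim/malg_ind: p q => [q|p1 p2 IH1 IH2 q|c M q].
- exact: (leibniz_zero q (pderivv0 x)).
- exact: (leibniz_addl (pderivvD x) (IH1 q) (IH2 q)).
apply: leibniz_sym; elim/malg_ind: q => [|q1 q2 IH1 IH2|c' N].
- exact: (leibniz_zero _ (pderivv0 x)).
- exact: (leibniz_addl (pderivvD x) IH1 IH2).
exact: pderivvM_monom.
Qed.

Lemma pderivv_free x p : degv x p = 0%N -> pderivv x p = 0.
Proof.
move=> px; rewrite /pderivv big_seq big1 // => M Mp.
by have := degv_ge x Mp; rewrite px leqn0 => /eqP ->; rewrite mulr0 scale0r.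
Qed.

Lemma pderivv_dvar x : pderivv x (dvar k x) = 1.
Proof.
rewrite pderivvU ucmE eqxx mulr1 scale1r; congr << _ >>.
by apply/eqP/cmP => i; rewrite divcmE cm1 subnn.
Qed.

Lemma degv_pderivv x y p : (degv y (pderivv x p) <= degv y p)%N.
Proof.
apply: degv_sum => M Mp; apply: leq_trans (degvZ _ _ _) _.
by rewrite degv_monom divcmE (leq_trans (leq_subr _ _)) // degv_ge.
Qed.

Lemma degv_lcoefv x y p : (degv y (lcoefv x p) <= degv y p - degv x p * (x == y))%N.
Proof.
rewrite /lcoefv -big_filter; apply: degv_sum => M; rewrite mem_filter => /andP[/eqP Mx Mp].
apply: leq_trans (degvZ _ _ _) _.
by rewrite degv_monom divcmE expcmnE Mx leq_sub2r // degv_ge.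
Qed.

Lemma lcoefv_free x p : degv x (lcoefv x p) = 0%N.
Proof. by apply/eqP; rewrite -leqn0 (leq_trans (degv_lcoefv _ _ _)) // eqxx muln1 subnn. Qed.

Lemma degv_lcoefv_le x y p : (degv y (lcoefv x p) <= degv y p)%N.
Proof. by rewrite (leq_trans (degv_lcoefv _ _ _)) // leq_subr. Qed.

Lemma dvarX x n : dvar k x ^+ n = << expcmn (ucm x) n >>.
Proof.
elim: n => [|n IH].
  by rewrite expr0; congr << _ >>; apply/eqP/cmP => y; rewrite cm1 expcmnE.
rewrite exprS IH -monomM; congr << _ >>; apply/eqP/cmP => y.
by rewrite cmM !expcmnE ucmE mulSn.
Qed.

Lemma lcoefv_split x p : exists r, [/\ p = lcoefv x p * dvar k x ^+ degv x p + r,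
  (0 < degv x p)%N -> (degv x r < degv x p)%N & forall y, (degv y r <= degv y p)%N].
Proof.
exists (\sum_(M <- msupp p | M x != degv x p) p@_M *: << M >>); split.
- rewrite {1}[p]monalgE (bigID (fun M : {cmonom T} => M x == degv x p)) /=; congr (_ + _).
    rewrite mulr_suml; apply: eq_bigr => M /eqP Mx.
    rewrite dvarX monom_scale -scalerAl -monomM; congr (_ *: << _ >>).
    apply/eqP/cmP => y; rewrite cmM divcmE !expcmnE Mx subnK //.
    by case: eqP => [<-|_]; rewrite ?muln0 // muln1 Mx.
  by apply: eq_bigr => M _; rewrite monom_scale.
- move=> d0; have E : ((degv x p).-1 < degv x p)%N by rewrite prednK.
  apply: leq_ltn_trans E; rewrite -big_filter; apply: degv_sum => M.
  rewrite mem_filter => /andP[Mx Mp]; apply: leq_trans (degvZ _ _ _) _.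
  by rewrite degv_monom -ltnS prednK // ltn_neqAle Mx degv_ge.
- move=> y; rewrite -big_filter; apply: degv_sum => M.
  rewrite mem_filter => /andP[Mx Mp]; apply: leq_trans (degvZ _ _ _) _.
  by rewrite degv_monom degv_ge.
Qed.

Lemma vars_sub p (P : pred T) : all P (vars p) <-> forall x, ~~ P x -> degv x p = 0%N.
Proof.
split=> [/allP H x Px|H].
  by apply: degv_vars; apply/negP => /H; rewrite (negbTE Px).
by apply/allP => x; rewrite mem_vars; apply: contraNT => /H ->.
Qed.

End Algebra.

(** * The highest derivative produced by a derivation *)

Section TopDerivative.
Variables (k : fieldType) (m l : nat) (delta : 'I_m -> k -> k).
Local Notation T := (Der m l).
Local Notation R := (DPoly k m l).

(** The chain rule with the summand of [u] isolated. The rest, including the derivation of the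
    coefficients, involves only variables of [p] and derivatives of those other than [u]. *)
Lemma dderiv_top i u (p : R) : exists q,
  dderiv delta i p = pderivv u p * dvar k (thetaD (deltaT i) u) + q /\
  forall y, degv y p = 0%N ->
    (forall x, x \in vars p -> x != u -> thetaD (deltaT i) x != y) -> degv y q = 0%N.
Proof.
pose F (M : {cmonom T}) x : R :=
  (M x)%:R *: (<< divcm M (ucm x) >> * dvar k (thetaD (deltaT i) x)).
pose C (M : {cmonom T}) : R := \sum_(x <- [seq x <- finsupp M | x != u]) F M x.
exists (\sum_(M <- msupp p) (delta i p@_M *: << M >> + p@_M *: C M)); split.
  rewrite mulr_suml -big_split; apply: eq_bigr => M _ /=.
  rewrite addrCA; congr (_ + _).
  have -> : \sum_(x <- finsupp M) F M x = F M u + C M.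
    rewrite /C big_filter (bigID (fun x => x == u)) /=; congr (_ + _).
    case: (boolP (u \in finsupp M)) => uM.
      by rewrite -big_filter (filter_pred1_uniq (fset_uniq _) uM) big_seq1.
    rewrite big1_seq; last by move=> x /andP[/eqP -> /(negP uM)].
    by move: uM; rewrite -cmE_eq0 /F => /eqP ->; rewrite scale0r.
  by rewrite scalerDr /F scalerA scalerAl.
move=> y y0 Hy; apply/eqP; rewrite -leqn0; apply: degv_sum => M Mp.
have My : M y = 0%N by apply/eqP; rewrite -leqn0; apply: leq_trans (degv_ge y Mp) _; rewrite y0.
apply: degvD; apply: leq_trans (degvZ _ _ _) _; first by rewrite degv_monom My.
apply: degv_sum => x; rewrite mem_filter => /andP[xu xM].
apply: leq_trans (degvZ _ _ _) _; apply: (@degvM_le _ _ _ _ _ _ 0 0).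
  by rewrite degv_monom divcmE My.
rewrite degv_dvar; case: eqP => // E.
have /Hy /(_ xu) : x \in vars p.
  rewrite mem_vars -lt0n; apply: leq_trans (degv_ge x Mp).
  by rewrite lt0n cmE_neq0.
by rewrite E eqxx.
Qed.

End TopDerivative.

(** * Evaluation at a point with coordinates in the base field *)

Section Evaluation.
Variables (k : fieldType) (m l : nat).
Local Notation T := (Der m l).
Local Notation R := (DPoly k m l).
Variable e : T -> k.

Definition evalm (M : {cmonom T}) : k := \prod_(x <- finsupp M) e x ^+ M x.

Lemma evalmw (D : {fset T}) (M : {cmonom T}) : (finsupp M `<=` D)%fset ->
  evalm M = \prod_(x <- D) e x ^+ M x.
Proof.
move=> MD; rewrite /evalm (big_fset_incl _ MD) // => x _.
by rewrite -cmE_eq0 => /eqP ->; rewrite expr0.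
Qed.

Lemma evalm_morphism : mmorphism evalm.
Proof.
split=> [M N|]; last by rewrite /evalm mdom1 big_seq_fset0.
have MN : (finsupp M `|` finsupp N `<=` finsupp M `|` finsupp N)%fset by [].
move: (MN); rewrite fsubUset => /andP[MD ND].
rewrite (evalmw MD) (evalmw ND) -big_split /evalm mdomD /=.
by apply: eq_bigr => x _; rewrite cmM exprD.
Qed.

HB.instance Definition _ := isMultiplicative.Build {cmonom T} k evalm evalm_morphism.

Definition evalp (p : R) : k := mmap idfun evalm p.

Lemma evalpD p q : evalp (p + q) = evalp p + evalp q.
Proof. exact: mmapD. Qed.

Lemma evalpM p q : evalp (p * q) = evalp p * evalp q.
Proof. exact: (@mmap_is_multiplicative _ _ _ idfun evalm).1. Qed.

Lemma evalpC c : evalp c%:MP = c.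
Proof. exact: (@mmapC _ _ _ idfun evalm). Qed.

Lemma evalp_dvar x : evalp (dvar k x) = e x.
Proof.
rewrite /evalp mmapU mul1r /= /evalm mdomU big_seq_fset1 ucmE eqxx.
by rewrite expr1.
Qed.

End Evaluation.

Lemma eq_evalp (k : fieldType) (m l : nat) (e e' : Der m l -> k) (p : DPoly k m l) :
  (forall x, degv x p != 0%N -> e x = e' x) -> evalp e p = evalp e' p.
Proof.
move=> H; apply: eq_big_seq => M Mp; congr (_ * _).
apply: eq_big_seq => x xM; congr (_ ^+ _); apply: H.
rewrite -lt0n; apply: leq_trans (degv_ge x Mp).
by rewrite lt0n cmE_neq0.
Qed.

(* Reduction and tangent vector fields only use these properties of degrees and
   partial derivatives, so they are developed over an abstract ring. *)
Record poly_like (T : eqType) (R : comRingType) := PolyLike {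
  pdeg : T -> R -> nat;
  pvar : T -> R;
  pdiff : T -> R -> R;
  psupp : R -> seq T;
  psupp_uniq p : uniq (psupp p);
  mem_psupp x p : (x \in psupp p) = (pdeg x p != 0)%N;
  pdeg0 x : pdeg x 0 = 0%N;
  pdeg1 x : pdeg x 1 = 0%N;
  pdegD x p q d : (pdeg x p <= d)%N -> (pdeg x q <= d)%N -> (pdeg x (p + q) <= d)%N;
  pdegN x p : pdeg x (- p) = pdeg x p;
  pdegM x p q : (pdeg x (p * q) <= pdeg x p + pdeg x q)%N;
  pdeg_var x w : pdeg x (pvar w) = (w == x);
  psplit w p : exists c r, [/\ p = c * pvar w ^+ pdeg w p + r, pdeg w c = 0%N,
    (forall x, (pdeg x c <= pdeg x p)%N), (forall x, (pdeg x r <= pdeg x p)%N) &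
    ((0 < pdeg w p)%N -> (pdeg w r < pdeg w p)%N)];
  pdiffD x p q : pdiff x (p + q) = pdiff x p + pdiff x q;
  pdiffM x p q : pdiff x (p * q) = pdiff x p * q + p * pdiff x q;
  pdiff_free x p : pdeg x p = 0%N -> pdiff x p = 0
}.

(** * Pseudo-reduction *)

Section Reduction.
Variables (T : eqType) (R : comRingType) (PL : poly_like T R).
Local Notation deg := (pdeg PL).
Local Notation X := (pvar PL).
Local Notation pd := (pdiff PL).
Implicit Types (p q r s f g a c H : R) (x v w : T).

Lemma pdegB x p q d : (deg x p <= d)%N -> (deg x q <= d)%N -> (deg x (p - q) <= d)%N.
Proof. by move=> Hp Hq; rewrite pdegD ?pdegN. Qed.

Lemma pdegM_le x p q d e : (deg x p <= d)%N -> (deg x q <= e)%N ->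
  (deg x (p * q) <= d + e)%N.
Proof. by move=> Hp Hq; apply: leq_trans (pdegM _ _ _ _) (leq_add Hp Hq). Qed.

Lemma pdegX_le x p n d : (deg x p <= d)%N -> (deg x (p ^+ n) <= n * d)%N.
Proof.
move=> Hp; elim: n => [|n IH]; first by rewrite expr0 pdeg1.
by rewrite exprS mulSn pdegM_le.
Qed.

Lemma pdegM0 x p q : deg x p = 0%N -> deg x q = 0%N -> deg x (p * q) = 0%N.
Proof. by move=> Hp Hq; apply/eqP; rewrite -leqn0 (@pdegM_le _ _ _ 0 0) ?Hp ?Hq. Qed.

Lemma pdegX0 x p n : deg x p = 0%N -> deg x (p ^+ n) = 0%N.
Proof.
by move=> Hp; apply/eqP; rewrite -leqn0 -(muln0 n) pdegX_le ?Hp.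
Qed.

Lemma pdegD0 x p q : deg x p = 0%N -> deg x q = 0%N -> deg x (p + q) = 0%N.
Proof. by move=> Hp Hq; apply/eqP; rewrite -leqn0 pdegD ?Hp ?Hq. Qed.

Lemma pdiff0 x : pd x 0 = 0.
Proof. by rewrite pdiff_free ?pdeg0. Qed.

Lemma pdiffN x p : pd x (- p) = - pd x p.
Proof. by apply/eqP; rewrite -addr_eq0 -pdiffD addNr pdiff0. Qed.

Lemma pdiff_sum x (J : Type) (s : seq J) (F : J -> R) :
  pd x (\sum_(t <- s) F t) = \sum_(t <- s) pd x (F t).
Proof. by rewrite (big_morph (pd x) (@pdiffD _ _ _ x) (pdiff0 x)). Qed.

Lemma pseudo_division w e a q g p : (0 < e)%N -> g = a * X w ^+ e + q ->
  (deg w q < e)%N -> deg w a = 0%N ->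
  exists n c r, [/\ a ^+ n * p = c * g + r, (deg w r < e)%N,
    (forall x, w != x -> deg x a = 0%N -> deg x g = 0%N -> (deg x r <= deg x p)%N) &
    (forall x, w != x -> deg x a = 0%N -> deg x g = 0%N -> deg x p = 0%N -> deg x c = 0%N)].
Proof.
move=> e0 gE qe a0.
have [d] := ubnP (deg w p); elim: d p => // d IH p.
rewrite ltnS => pd'; case: (ltnP (deg w p) e) => pe.
  exists 0%N, 0, p; split=> //; first by rewrite expr0; ring.
  by move=> *; rewrite pdeg0.
have [c [p' [pE c0 cp p'p p'w]]] := psplit PL w p.
set D := deg w p in pE p'w pe pd' *.
have D0 : (0 < D)%N := leq_trans e0 pe.
have XE : X w ^+ D = X w ^+ (D - e) * X w ^+ e by rewrite -exprD subnK.
pose p1 := a * p - c * X w ^+ (D - e) * g.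
have p1E : p1 = a * p' - c * X w ^+ (D - e) * q.
  by rewrite /p1 pE gE XE; ring.
have p1w : (deg w p1 <= D.-1)%N.
  rewrite p1E; apply: pdegB.
    by apply: (@pdegM_le _ _ _ 0); rewrite ?a0 // -ltnS prednK // p'w.
  have -> : D.-1 = (0 + (D - e) + e.-1)%N.
    by move: pe e0; case: (D) (e) => [|D'] [|e'] //= pe _; rewrite add0n subSS subnK.
  rewrite !pdegM_le ?c0 //; last by rewrite -ltnS prednK.
  by rewrite -[X in (_ <= X)%N]muln1 pdegX_le // pdeg_var eqxx.
have fr x : w != x -> deg x a = 0%N -> deg x g = 0%N -> (deg x p1 <= deg x p)%N.
  move=> wx ax gx; apply: pdegB.
    by rewrite -[X in (_ <= X)%N]add0n pdegM_le ?ax.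
  rewrite -[X in (_ <= X)%N]addn0 -[X in (_ <= X + _)%N]addn0.
  rewrite !pdegM_le ?gx // pdegX0 //; apply/eqP; rewrite -leqn0.
  by rewrite pdeg_var (negbTE wx).
have [|n [c1 [r [rE rw rx cx]]]] := IH p1.
  by apply: leq_ltn_trans p1w _; rewrite prednK.
exists n.+1, (c1 + a ^+ n * c * X w ^+ (D - e)), r; split=> //.
- have -> : a ^+ n.+1 * p = a ^+ n * p1 + a ^+ n * c * X w ^+ (D - e) * g.
    by rewrite exprS /p1; ring.
  by rewrite rE; ring.
- by move=> x wx ax gx; apply: leq_trans (rx x wx ax gx) (fr x wx ax gx).
move=> x wx ax gx px.
apply: pdegD0.
  apply: cx => //; apply/eqP; rewrite -leqn0.
  by apply: leq_trans (fr x wx ax gx) _; rewrite px.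
apply: pdegM0; last by rewrite pdegX0 // pdeg_var (negbTE wx).
apply: pdegM0; first by rewrite pdegX0.
by apply/eqP; rewrite -leqn0 -px.
Qed.

Definition supp_in (V : pred T) p := forall x, ~~ V x -> deg x p = 0%N.

Lemma supp_inM V p q : supp_in V p -> supp_in V q -> supp_in V (p * q).
Proof. by move=> Hp Hq x Vx; rewrite pdegM0 ?Hp ?Hq. Qed.

Lemma supp_in1 V : supp_in V 1.
Proof. by move=> x _; rewrite pdeg1. Qed.

Lemma supp_inX V p n : supp_in V p -> supp_in V (p ^+ n).
Proof. by move=> Hp x Vx; rewrite pdegX0 ?Hp. Qed.

(** The cofactors are confined to [V], so that one notion serves for ideals of the whole ring and of
    R_h. *)
Definition idl (V : pred T) (Gen : R -> Prop) p : Prop :=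
  exists s : seq (R * R),
    (forall t, t \in s -> supp_in V t.1 /\ Gen t.2) /\
    p = \sum_(t <- s) t.1 * t.2.

Lemma idl0 V Gen : idl V Gen 0.
Proof. by exists [::]; split => //; rewrite big_nil. Qed.

Lemma idlD V Gen p q : idl V Gen p -> idl V Gen q -> idl V Gen (p + q).
Proof.
move=> [s [Hs ->]] [t [Ht ->]]; exists (s ++ t); split; last by rewrite big_cat.
by move=> u; rewrite mem_cat => /orP[/Hs|/Ht].
Qed.

Lemma idlM V Gen c p : supp_in V c -> idl V Gen p -> idl V Gen (c * p).
Proof.
move=> Hc [s [Hs ->]]; exists [seq (c * t.1, t.2) | t <- s]; split.
  move=> _ /mapP[t /Hs [H1 H2] ->]; split=> //.
  exact: supp_inM.
by rewrite big_map mulr_sumr; apply: eq_bigr => t _; rewrite mulrA.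
Qed.

Lemma idl_gen V (Gen : R -> Prop) g : Gen g -> idl V Gen g.
Proof.
move=> Hg; exists [:: (1, g)]; split; last by rewrite big_seq1 mul1r.
by move=> t; rewrite inE => /eqP -> /=; split=> //; apply: supp_in1.
Qed.

Lemma idl_mono V (Gen Gen' : R -> Prop) p :
  (forall g, Gen g -> Gen' g) -> idl V Gen p -> idl V Gen' p.
Proof. by move=> H [s [Hs ->]]; exists s; split=> // t /Hs [? /H]. Qed.

Lemma idl_sub V (Gen J : R -> Prop) p : J 0 -> (forall a b, J a -> J b -> J (a + b)) ->
  (forall a b, J b -> J (a * b)) -> (forall g, Gen g -> J g) -> idl V Gen p -> J p.
Proof.
move=> J0 JD JM JG [s [Hs ->]]; rewrite big_seq.
by apply: big_ind => // t /Hs [_ /JG]; apply: JM.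
Qed.

(** The generators are constants for [pd v], so only the cofactors get differentiated. *)
Lemma idl_pdiff V (Gen : R -> Prop) v p : (forall g, Gen g -> deg v g = 0%N) ->
  idl V Gen p -> idl predT Gen (pd v p).
Proof.
move=> Hv [s [Hs ->]]; exists [seq (pd v t.1, t.2) | t <- s]; split.
  by move=> _ /mapP[t /Hs [_ H2] ->]; split.
rewrite big_map pdiff_sum; apply: eq_big_seq => t /Hs [_ /Hv /pdiff_free H].
by rewrite pdiffM H mulr0 addr0.
Qed.

Definition divides_power (V : pred T) H s : Prop :=
  exists e b, supp_in V b /\ s * b = H ^+ e.

Lemma divides_power1 V H : divides_power V H 1.
Proof. by exists 0%N, 1; split; [exact: supp_in1 | rewrite mulr1 expr0]. Qed.

Lemma divides_powerM V H s t :
  divides_power V H s -> divides_power V H t -> divides_power V H (s * t).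
Proof.
move=> [e [b [Vb E]]] [e' [b' [Vb' E']]]; exists (e + e')%N, (b * b'); split.
  exact: supp_inM.
by rewrite exprD -E -E'; ring.
Qed.

Lemma divides_powerX V H s n : divides_power V H s -> divides_power V H (s ^+ n).
Proof.
move=> Hs; elim: n => [|n IH]; first by rewrite expr0; apply: divides_power1.
by rewrite exprS; apply: divides_powerM.
Qed.

Variable nu : T -> nat.
Hypothesis nu_inj : injective nu.

(** A triple at [w] holds a polynomial with leader [w], its degree and its leading coefficient in
    [w]. Leading coefficients and separants become units once [H] is inverted. *)
Definition good_family (V : pred T) H (G : T -> option (nat * R * R)) : Prop :=
  forall w e a g, G w = Some (e, a, g) ->
  [/\ (0 < e)%N, exists2 q, g = a * X w ^+ e + q & (deg w q < e)%N,
      deg w a = 0%N /\ (forall x, (nu w < nu x)%N -> deg x a = 0%N /\ deg x g = 0%N),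
      divides_power V H a & divides_power V H (pd w g)].

Definition gens (G : T -> option (nat * R * R)) (V : pred T) (N : nat) g : Prop :=
  exists w e a, [/\ (nu w < N)%N, V w & G w = Some (e, a, g)].

(** Division proceeds from the highest index downwards. Generators with a lower leader are free of
    the variable just treated, so its degree is not raised again. *)
Lemma pseudo_reduction V H G p N : good_family V H G ->
  (forall x w, V w -> (nu x <= nu w)%N -> V x) -> supp_in V p ->
  exists s r, [/\ divides_power V H s /\ supp_in V s,
    (forall x, (N <= nu x)%N -> deg x s = 0%N),
    idl V (gens G V N) (s * p - r),
    (forall w e a g, (nu w < N)%N -> G w = Some (e, a, g) -> (deg w r < e)%N) &
    supp_in V r /\ (forall x, (N <= nu x)%N -> (deg x r <= deg x p)%N)].
Proof.
move=> gG Vdown; elim: N p => [|N IH] p Vp.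
  exists 1, p; split=> //.
  - by split; [exact: divides_power1 | exact: supp_in1].
  - by move=> x _; rewrite pdeg1.
  - by rewrite mul1r subrr; apply: idl0.
case: (classic (exists w e a g, [/\ nu w = N, V w & G w = Some (e, a, g)])) => [|noG]; last first.
  have [s [r [Hs sx sp rw [Vr rx]]]] := IH p Vp.
  exists s, r; split=> //.
  - by move=> x /ltnW; apply: sx.
  - apply: idl_mono sp => g [w [e [a [wN Vw Gw]]]].
    by exists w, e, a; split=> //; apply: ltnW.
  - move=> w e a g; rewrite ltnS leq_eqVlt => /orP[/eqP wN|]; last exact: rw.
    move=> Gw; have [e0 _ _ _ _] := gG _ _ _ _ Gw.
    case: (boolP (V w)) => Vw; first by case: noG; exists w, e, a, g.
    by rewrite Vr.
  - by split=> // x /ltnW; apply: rx.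
move=> [w [e [a [g [wN Vw Gw]]]]].
have [e0 [q gE qw] [aw agx] Ha _] := gG _ _ _ _ Gw.
have above x : ~~ V x -> (nu w < nu x)%N.
  by move=> Vx; rewrite ltnNge; apply/negP => /(Vdown _ _ Vw); apply/negP.
have wneq x : (nu w < nu x)%N -> w != x by apply: contraTneq => ->; rewrite ltnn.
have [n [c [r1 [rE r1w r1x cx]]]] := pseudo_division p e0 gE qw aw.
have Vr1 : supp_in V r1.
  move=> x Vx; have xw := above _ Vx; have [ax gx] := agx _ xw.
  apply/eqP; rewrite -leqn0; apply: leq_trans (r1x x (wneq _ xw) ax gx) _.
  by rewrite Vp.
have Vc : supp_in V c.
  move=> x Vx; have xw := above _ Vx; have [ax gx] := agx _ xw.
  by apply: cx => //; [exact: wneq | exact: Vp].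
have Va : supp_in V a by move=> x /above /agx [].
have [s [r [[Hs Vs] sx sp rw [Vr rx]]]] := IH r1 Vr1.
exists (s * a ^+ n), r; split=> //.
- split; first by apply: divides_powerM => //; apply: divides_powerX.
  by apply: supp_inM => //; apply: supp_inX.
- move=> x Nx; apply: pdegM0; first by apply: sx; apply: ltnW.
  by apply: pdegX0; have [] := agx x; rewrite ?wN.
- have -> : s * a ^+ n * p - r = s * c * g + (s * r1 - r).
    by rewrite -mulrA rE; ring.
  apply: idlD.
    apply: idlM; first exact: supp_inM.
    by apply: idl_gen; exists w, e, a; rewrite wN.
  apply: idl_mono sp => g' [w' [e' [a' [w'N Vw' Gw']]]].
  by exists w', e', a'; split=> //; apply: ltnW.
- move=> w' e' a' g'; rewrite ltnS leq_eqVlt => /orP[/eqP w'N|]; last exact: rw.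
  have -> : w' = w by apply: nu_inj; rewrite wN.
  rewrite Gw => -[<- _ _]; apply: leq_ltn_trans r1w.
  by apply: rx; rewrite wN.
split=> // x Nx; apply: leq_trans (rx x (ltnW Nx)) _.
have xw : (nu w < nu x)%N by rewrite wN.
have [ax gx] := agx _ xw.
by apply: r1x => //; apply: wneq.
Qed.

End Reduction.

(** * Vector fields tangent to a family *)

Section VectorField.
Variables (T : eqType) (R : comRingType) (PL : poly_like T R).
Local Notation deg := (pdeg PL).
Local Notation X := (pvar PL).
Local Notation pd := (pdiff PL).
Implicit Types (p q r s f g a c H : R) (x v w : T) (d : T -> R).

(** The vector field with components [d]; only the finitely many variables of [p] contribute. *)
Definition vfield d p := \sum_(x <- psupp PL p) pd x p * d x.

Lemma vfieldE d p (D : seq T) : uniq D -> {subset psupp PL p <= D} ->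
  vfield d p = \sum_(x <- D) pd x p * d x.
Proof.
move=> uD pD; rewrite [RHS](bigID (fun x => x \in psupp PL p)) /=.
rewrite [X in _ + X]big1 ?addr0; last first.
  move=> x; rewrite mem_psupp negbK => /eqP px.
  by rewrite pdiff_free ?mul0r.
rewrite -big_filter; apply: perm_big; apply: uniq_perm.
- exact: psupp_uniq.
- exact: filter_uniq.
by move=> x; rewrite mem_filter; case: (boolP (x \in _)) => //= /pD ->.
Qed.

Lemma vfieldM d p q : vfield d (p * q) = vfield d p * q + p * vfield d q.
Proof.
pose D := undup (psupp PL p ++ psupp PL q ++ psupp PL (p * q)).
have uD : uniq D := undup_uniq _.
rewrite !(@vfieldE d _ D) //; first last.
- by move=> x; rewrite mem_undup !mem_cat => ->; rewrite ?orbT.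
- by move=> x; rewrite mem_undup !mem_cat => ->; rewrite ?orbT.
- by move=> x; rewrite mem_undup !mem_cat => ->; rewrite ?orbT.
rewrite mulr_suml mulr_sumr -big_split; apply: eq_bigr => x _ /=.
by rewrite pdiffM; ring.
Qed.

Lemma vfieldD d p q : vfield d (p + q) = vfield d p + vfield d q.
Proof.
pose D := undup (psupp PL p ++ psupp PL q ++ psupp PL (p + q)).
have uD : uniq D := undup_uniq _.
rewrite !(@vfieldE d _ D) //; first last.
- by move=> x; rewrite mem_undup !mem_cat => ->; rewrite ?orbT.
- by move=> x; rewrite mem_undup !mem_cat => ->; rewrite ?orbT.
- by move=> x; rewrite mem_undup !mem_cat => ->; rewrite ?orbT.
rewrite -big_split; apply: eq_bigr => x _ /=.
by rewrite pdiffD; ring.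
Qed.

Lemma vfield0 d : vfield d 0 = 0.
Proof. by rewrite /vfield big1 // => x _; rewrite pdiff0 mul0r. Qed.

Lemma eq_vfield d d' p : (forall x, deg x p != 0%N -> d x = d' x) -> vfield d p = vfield d' p.
Proof. by move=> E; apply: eq_big_seq => x; rewrite mem_psupp => /E ->. Qed.

Lemma vfieldZ s d p : vfield (fun x => s * d x) p = s * vfield d p.
Proof. by rewrite /vfield mulr_sumr; apply: eq_bigr => x _; ring. Qed.

Lemma vfield_single d v p : (forall x, deg x p != 0%N -> x != v -> d x = 0) ->
  vfield d p = pd v p * d v.
Proof.
move=> d0; case: (boolP (v \in psupp PL p)) => [vp|vp].
  rewrite /vfield (bigD1_seq v) ?psupp_uniq //= big1_seq ?addr0 // => x.
  by rewrite mem_psupp => /andP[xv xp]; rewrite d0 ?mulr0.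
have -> : pd v p = 0 by move: vp; rewrite mem_psupp negbK => /eqP /pdiff_free.
rewrite mul0r /vfield big1_seq // => x /andP[_ xp].
rewrite d0 ?mulr0 -?mem_psupp //.
by apply: contraNneq vp => <-.
Qed.

Variable nu : T -> nat.
Hypothesis nu_inj : injective nu.
Variables (V : pred T) (H : R) (G : T -> option (nat * R * R)).
Hypothesis gG : good_family PL nu V H G.

(* The values of the field are found by solving D g_w = 0 for D w in increasing
   order of w; the division by the separant is avoided by rescaling D. *)
Lemma tangent_field v N : G v = None -> exists d,
  [/\ forall x, (nu x < nu v)%N -> d x = 0, divides_power PL V H (d v) &
      forall w e a g, (nu w < N)%N -> G w = Some (e, a, g) -> vfield d g = 0].
Proof.
move=> Gv; elim: N => [|N [d [dv Hd dG]]].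
  exists (fun x => if x == v then 1 else 0); split=> //.
    by move=> x; case: eqP => // ->; rewrite ltnn.
  by rewrite eqxx; apply: divides_power1.
case: (classic (exists w e a g, [/\ nu w = N, (nu v < nu w)%N & G w = Some (e, a, g)]))
    => [|noG]; last first.
  (* No generator of index [N] has its leader above [v], and [v] carries none. Hence all variables
     of such a generator lie below [v], where [d] vanishes. *)
  exists d; split=> // w e a g; rewrite ltnS leq_eqVlt => /orP[/eqP wN|]; last exact: dG.
  move=> Gw; have [_ _ [_ gx] _ _] := gG Gw.
  rewrite /vfield big1_seq // => x /andP[_]; rewrite mem_psupp => xg.
  rewrite dv ?mulr0 //; have xw : (nu x <= nu w)%N.
    by rewrite leqNgt; apply/negP => /gx[_]; apply/eqP.
  have wv : (nu w < nu v)%N.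
    rewrite ltn_neqAle leqNgt; apply/andP; split; last first.
      by apply/negP => vw; case: noG; exists w, e, a, g.
    by apply/eqP => /nu_inj E; move: Gw; rewrite E Gv.
  exact: leq_ltn_trans xw wv.
move=> [w [e [a [g [wN vw Gw]]]]].
have [_ _ [_ gx] _ HS] := gG Gw.
pose d0 x := if x == w then 0 else d x.
pose d' x := if x == w then - vfield d0 g else pd w g * d x.
have wneq x : (nu x < nu w)%N -> (x == w) = false.
  by move=> xw; apply/eqP => E; move: xw; rewrite E ltnn.
exists d'; split.
- by move=> x xv; rewrite /d' wneq ?dv ?mulr0 // (ltn_trans xv).
- by rewrite /d' wneq //; apply: divides_powerM.
move=> w' e' a' g'; rewrite ltnS leq_eqVlt => /orP[/eqP w'N|w'N] Gw'; last first.
  have [_ _ [_ gx'] _ _] := gG Gw'.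
  rewrite (@eq_vfield _ (fun x => pd w g * d x)).
    by rewrite vfieldZ (dG _ _ _ _ w'N Gw') mulr0.
  move=> x xg'; rewrite /d' wneq // wN; apply: leq_ltn_trans w'N.
  by rewrite leqNgt; apply/negP => /gx'[_]; apply/eqP.
have E : w' = w by apply: nu_inj; rewrite wN.
move: Gw'; rewrite E Gw => -[_ _ <-] {w' e' a' g' w'N E}.
pose D := undup (w :: psupp PL g).
have uD : uniq D := undup_uniq _.
have gD : {subset psupp PL g <= D} by move=> x; rewrite mem_undup inE => ->; rewrite orbT.
have wD : w \in D by rewrite mem_undup mem_head.
rewrite (vfieldE d' uD gD) (bigD1_seq w) //= {1}/d' eqxx (vfieldE d0 uD gD).
rewrite [in X in X + _](bigD1_seq w) //= {1}/d0 eqxx mulr0 add0r mulrN mulr_sumr.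
rewrite addrC; apply/eqP; rewrite subr_eq0; apply/eqP.
by apply: eq_bigr => x /negbTE xw; rewrite /d' /d0 xw; ring.
Qed.

Variable J : R -> Prop.
Hypotheses (J0 : J 0) (JD : forall a b, J a -> J b -> J (a + b))
  (JM : forall a b, J b -> J (a * b)) (Jrad : forall a n, J (a ^+ n) -> J a).
Hypothesis JG : forall w e a g, G w = Some (e, a, g) -> J g.
Hypothesis Jred : forall p, J p -> exists s N,
  divides_power PL V H s /\ idl PL V (gens nu G V N) (s * p).

Definition sat p := exists e, J (H ^+ e * p).

Lemma sat_divides s p : divides_power PL V H s -> J (s * p) -> sat p.
Proof.
move=> [e [b [_ E]]] Jsp; exists e.
by have -> : H ^+ e * p = b * (s * p); [rewrite -E; ring | apply: JM].
Qed.

(** Some multiple [t * f * g] is a combination of finitely many generators. A field D tangent to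
    these maps it into [J], and D [g] is [pd v g * d v] because D vanishes on the variables below
    [v]. *)
Lemma sat_pdiff f g v : G v = None -> (forall x, (nu v < nu x)%N -> deg x g = 0%N) ->
  sat (f * g) -> sat (f * pd v g).
Proof.
move=> Gv gv [e /Jred[s [N [Hs Is]]]].
have [d [dv Hd dG]] := tangent_field N Gv.
pose t := s * H ^+ e.
have tfg : s * (H ^+ e * (f * g)) = t * f * g by rewrite /t; ring.
rewrite {}tfg in Is.
have Jtfg : J (t * f * g).
  by apply: idl_sub Is => // g' [w [e' [a [_ _ /JG]]]].
have JDt : J (vfield d (t * f * g)).
  case: Is => u [Hu ->]; rewrite (big_morph (vfield d) (vfieldD d) (vfield0 d)) big_seq.
  apply: big_ind => // z /Hu [_ [w [e' [a [wN _ Gw]]]]].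
  rewrite vfieldM (dG _ _ _ _ wN Gw) mulr0 addr0; apply: JM.
  exact: JG Gw.
have Dg : vfield d g = pd v g * d v.
  apply: vfield_single => x xg xv; apply: dv; rewrite ltn_neqAle leqNgt.
  apply/andP; split; first by apply: contra xv => /eqP /nu_inj ->.
  by apply/negP => /gv; apply/eqP.
(* The unknown term D([t * f]) [* g] of the product rule is removed by multiplying with [t * f],
   since [t * f * g] lies in [J]; this leaves a square, and [J] is radical. *)
have J2 : J ((t * d v * (f * pd v g)) ^+ 2).
  have -> : (t * d v * (f * pd v g)) ^+ 2 = pd v g * d v * (t * f * vfield d (t * f * g)
      - vfield d (t * f) * (t * f * g)).
    by rewrite [vfield d (t * f * g)]vfieldM Dg; ring.
  apply: (JM (pd v g * d v)); apply: JD; first exact: JM.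
  by rewrite -mulNr; apply: JM.
apply: (@sat_divides (t * d v)); last exact: Jrad J2.
apply: divides_powerM => //; apply: divides_powerM => //.
by exists e, 1; split; [exact: supp_in1 | rewrite mulr1].
Qed.

End VectorField.

(** * Orderly rankings *)

Section OrderlyRanking.
Variables (m l : nat).
Local Notation T := (Der m l).
Implicit Types (t : Theta m) (u v w x y : T).

Definition below u w : bool := (u.1 == w.1) && [forall i, (u.2 i <= w.2 i)%N].
Definition quotT u w : Theta m := [ffun i => (w.2 i - u.2 i)%N].

Lemma thetaD_quot u w : below u w -> w = thetaD (quotT u w) u.
Proof.
case: u w => [j t] [j' t'] /andP[/eqP /= -> /forallP H]; congr (_, _).
by apply/ffunP => i; rewrite !ffunE /= subnK.
Qed.

Lemma below_thetaD t u : below u (thetaD t u).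
Proof. by rewrite /below /= eqxx; apply/forallP => i; rewrite ffunE leq_addl. Qed.

Lemma thetaD_inj t : injective (thetaD t : T -> T).
Proof.
move=> [j s] [j' s'] [-> /ffunP E]; congr (_, _); apply/ffunP => i.
by have := E i; rewrite !ffunE => /addnI.
Qed.

Lemma proper_derivativeE u w : proper_derivative u w = below u w && (u != w).
Proof. by rewrite /proper_derivative /below andbA. Qed.

Lemma below_refl u : below u u.
Proof. by rewrite /below eqxx; apply/forallP. Qed.

Lemma below_trans u v w : below u v -> below v w -> below u w.
Proof.
rewrite /below => /andP[/eqP -> /forallP uv] /andP[-> /forallP vw].
by apply/forallP => i; apply: leq_trans (uv i) (vw i).
Qed.

Lemma ordD_thetaD t u : ordD (thetaD t u) = (ordT t + ordD u)%N.
Proof. by rewrite /ordD /ordT -big_split; apply: eq_bigr => i _; rewrite ffunE. Qed.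

Lemma ordD_below u w : below u w -> (ordD u <= ordD w)%N.
Proof. by move=> /thetaD_quot ->; rewrite ordD_thetaD leq_addl. Qed.

Lemma leq_ordT t i : (t i <= ordT t)%N.
Proof. by rewrite /ordT (bigD1 i) //= leq_addr. Qed.

Variable rk : rel T.
Hypotheses (rk_ranking : is_ranking rk) (rk_orderly : is_orderly rk).

(** Bounding each exponent by [h] gives a finite list containing every derivative of order at most
    [h]. *)
Definition bounded_order h : seq T :=
  [seq (j, [ffun i => (f i : nat)]) | j : 'I_l <- enum 'I_l,
     f : {ffun 'I_m -> 'I_h.+1} <- enum {ffun 'I_m -> 'I_h.+1}].

Lemma mem_bounded_order u : u \in bounded_order (ordD u).
Proof.
case: u => j t; apply/allpairsP.
exists (j, [ffun i => inord (t i) : 'I_(ordT t).+1]); rewrite !mem_enum; split=> //=.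
congr (_, _); apply/ffunP => i; rewrite !ffunE inordK // ltnS.
exact: leq_ordT.
Qed.

Lemma rk_ordD u v : rk u v -> (ordD u <= ordD v)%N.
Proof.
have [[_ anti _ _] _ _] := rk_ranking.
move=> uv; rewrite leqNgt; apply/negP => /rk_orderly /andP[vu /eqP]; apply.
by apply: anti; rewrite uv vu.
Qed.

(* Finitely many derivatives lie below a given one, so that the position of a
   derivative in the ranking is a natural number. *)
Lemma orderly_index : exists nu : T -> nat,
  injective nu /\ forall u v, rk u v = (nu u <= nu v)%N.
Proof.
have [[refl anti trans tot] _ _] := rk_ranking.
pose lower u := undup [seq v <- bounded_order (ordD u) | rk v u && (v != u)].
have lowerE u v : (v \in lower u) = rk v u && (v != u).
  rewrite mem_undup mem_filter; case: (boolP (rk v u && _)) => //= /andP[vu _].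
  have := mem_bounded_order v; case/allpairsP=> -[j f] [_ _ vE]; apply/allpairsP.
  have le i : (v.2 i <= ordD u)%N.
    apply: leq_trans (rk_ordD vu).
      exact: leq_ordT.
  exists (v.1, [ffun i => inord (v.2 i) : 'I_(ordD u).+1]); rewrite !mem_enum; split=> //=.
  rewrite [LHS]surjective_pairing; congr (_, _).
  by apply/ffunP => i; rewrite !ffunE inordK // ltnS.
pose nu u := size (lower u).
have lt u v : rk u v -> u != v -> (nu u < nu v)%N.
  move=> uv ne; apply: (@uniq_leq_size _ (u :: lower u)) => [/=|x].
    by rewrite undup_uniq lowerE eqxx andbF.
  rewrite inE !lowerE => /orP[/eqP ->|/andP[xu xneu]]; first by rewrite uv.
  rewrite (trans _ _ _ xu uv); apply: contraNneq ne => E.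
  by apply/eqP; apply: anti; rewrite uv -E.
have rkE u v : rk u v = (nu u <= nu v)%N.
  apply/idP/idP => [uv|].
    by case: (eqVneq u v) => [->|/(lt _ _ uv)/ltnW].
  case/orP: (tot u v) => // vu uv.
  case: (eqVneq v u) => [->|/(lt _ _ vu)]; first exact: refl.
  by rewrite ltnNge uv.
exists nu; split=> // u v E.
by apply: anti; rewrite !rkE E leqnn.
Qed.

End OrderlyRanking.

Definition dpoly_like (k : fieldType) (m l : nat) : poly_like (Der m l) (DPoly k m l).
Proof.
refine (@PolyLike _ _ (@degv k m l) (@dvar k m l) (@pderivv k m l) (@vars k m l)
  _ _ _ _ _ _ _ _ _ _ _ _).
- by move=> p; apply: undup_uniq.
- by move=> x p; apply: mem_vars.
- exact: degv0.
- exact: degv1.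
- exact: degvD.
- exact: degvN.
- exact: degvM.
- exact: degv_dvar.
- move=> w p; have [r [pE rw rx]] := lcoefv_split w p.
  exists (lcoefv w p), r; split; [exact: pE | exact: lcoefv_free | | exact: rx | exact: rw].
  by move=> x; apply: degv_lcoefv_le.
- exact: pderivvD.
- exact: pderivvM.
- exact: pderivv_free.
Defined.

Lemma generator_deriv (T : eqType) (S : comRingType) (PL : poly_like T S) w (s q : S) :
  pdeg PL w s = 0%N -> pdeg PL w q = 0%N -> pdiff PL w (pvar PL w) = 1 ->
  pdiff PL w (s * pvar PL w + q) = s.
Proof.
by move=> s0 q0 X1; rewrite pdiffD pdiffM (pdiff_free s0) (pdiff_free q0) X1 mul0r add0r mulr1 addr0.
Qed.

Lemma linear_expr1 (S : comRingType) (s x q : S) : s * x + q = s * x ^+ 1 + q.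
Proof. by rewrite expr1. Qed.

(** * Leaders, and the generators obtained by differentiating a set *)

Section Generators.
Variables (k : fieldType) (m l : nat) (delta : 'I_m -> k -> k).
Local Notation T := (Der m l).
Local Notation R := (DPoly k m l).
Local Notation PL := (dpoly_like k m l).
Variables (rk : rel T) (nu : T -> nat).
Hypotheses (rk_ranking : is_ranking rk) (rk_orderly : is_orderly rk).
Hypotheses (nu_inj : injective nu) (rkE : forall u v, rk u v = (nu u <= nu v)%N).
Local Notation leader := (leader rk).
Implicit Types (p q c f g : R) (u v w x y : T) (t : Theta m) (A : seq R).

Lemma nu_ordD u v : (nu u <= nu v)%N -> (ordD u <= ordD v)%N.
Proof. by rewrite -rkE; apply: rk_ordD. Qed.

Lemma nu_thetaD t u v : (nu u < nu v)%N -> (nu (thetaD t u) < nu (thetaD t v))%N.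
Proof.
move=> uv; rewrite ltn_neqAle -rkE; have [_ _ mono] := rk_ranking.
rewrite mono ?andbT; last by rewrite rkE ltnW.
by apply: contraTneq uv => /nu_inj /thetaD_inj ->; rewrite ltnn.
Qed.

Lemma nu_below u v : below u v -> (nu u <= nu v)%N.
Proof. by move=> /thetaD_quot ->; rewrite -rkE; have [_] := rk_ranking. Qed.

Lemma nu_proper u v : proper_derivative u v -> (nu u < nu v)%N.
Proof.
rewrite proper_derivativeE => /andP[/nu_below uv ne]; rewrite ltn_neqAle uv andbT.
by apply: contra ne => /eqP /nu_inj ->.
Qed.

Lemma leader_spec p : if leader p is Some u then
    u \in vars p /\ (forall x, x \in vars p -> (nu x <= nu u)%N)
  else vars p = [::].
Proof.
rewrite /Defs.leader; elim: (vars p) => [//|v s] /=.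
case: (foldr _ _ s) => [a [aS Ha]|->]; last first.
  by split=> [|x]; rewrite inE // => /eqP ->.
rewrite rkE; case: leqP => av; split; rewrite ?inE ?eqxx ?aS ?orbT // => x.
  by rewrite inE => /orP[/eqP ->|/Ha xa] //; apply: leq_trans xa av.
by rewrite inE => /orP[/eqP ->|/Ha xa] //; apply: ltnW.
Qed.

Lemma leaderP p u : leader p = Some u <->
  (0 < degv u p)%N /\ (forall x, (nu u < nu x)%N -> degv x p = 0%N).
Proof.
have := leader_spec p; split=> [E|[u0 Hu]].
  move: H; rewrite E mem_vars -lt0n => -[H1 H2]; split=> // x xu.
  by apply/degv_vars/negP => /H2; rewrite leqNgt xu.
have uV : u \in vars p by rewrite mem_vars -lt0n.
case: (leader p) H => [v [vV Hv]|H]; last by rewrite H in uV.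
congr Some; apply: nu_inj; apply/eqP; rewrite eqn_leq Hv // andbT.
rewrite leqNgt; apply/negP => /Hu /eqP.
by move: vV; rewrite mem_vars => /negbTE ->.
Qed.

Lemma leader_notin_k p : notin_k p -> exists u, leader p = Some u.
Proof.
rewrite /notin_k; have := leader_spec p; case: (leader p) => [u _ _|->] //.
by exists u.
Qed.

Lemma leader_Some_notin_k p u : leader p = Some u -> notin_k p.
Proof.
have := leader_spec p; case: (leader p) => [v [vV _] _|] //.
by rewrite /notin_k; apply: contraTneq vV => ->.
Qed.

Lemma initialE c u : leader c = Some u -> initial rk c = lcoefv u c.
Proof. by rewrite /initial => ->. Qed.

Lemma separantE c u : leader c = Some u -> separant rk c = pderivv u c.
Proof. by rewrite /separant => ->. Qed.

Section Shape.
Variables (f : R) (u : T).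
Hypothesis fu : leader f = Some u.
Let S := pderivv u f.

(** The invariant of repeated differentiation of [f]: either nothing has been applied yet, or the
    result is linear in its leader [w] with the separant of [f] as coefficient. *)
Let shape w p := (w = u /\ p = f) \/ ((nu u < nu w)%N /\
  exists q, p = S * dvar k w + q /\ forall y, (nu w <= nu y)%N -> degv y q = 0%N).

Let S_free x : (nu u < nu x)%N -> degv x S = 0%N.
Proof.
move=> ux; apply/eqP; rewrite -leqn0; apply: leq_trans (degv_pderivv _ _ _) _.
by have [_ ->] := (leaderP f u).1 fu.
Qed.

Let shape_above w p y : shape w p -> (nu w < nu y)%N -> degv y p = 0%N.
Proof.
case=> [[-> ->]|[uw [q [-> Hq]]]] wy; first by have [_ ->] := (leaderP f u).1 fu.
apply: (@pdegD0 _ _ PL); last by apply: Hq; apply: ltnW.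
apply: (@pdegM0 _ _ PL); first by apply: S_free; apply: ltn_trans wy.
by rewrite /= degv_dvar; case: eqP => // E; rewrite E ltnn in wy.
Qed.

Let shape_pderivv w p : shape w p -> pderivv w p = S.
Proof.
case=> [[-> ->]|[uw [q [-> Hq]]]]; first exact: erefl.
exact: (@generator_deriv _ _ PL w S q (S_free uw) (Hq _ (leqnn _)) (pderivv_dvar k w)).
Qed.

(** The other variables of [p] lie below [w], and differentiation is strictly monotone, so the new
    leader arises from [w] alone. Its coefficient is the partial derivative in [w], which is [S] in
    both cases of the invariant. *)
Let shape_step i w p : shape w p -> shape (thetaD (deltaT i) w) (dderiv delta i p).
Proof.
move=> sh; have [q [E Hq]] := dderiv_top delta i w p.
have wd : (nu w < nu (thetaD (deltaT i) w))%N.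
  apply: nu_proper; rewrite proper_derivativeE below_thetaD /=.
  apply/eqP => /(congr1 (@ordD m l)); rewrite ordD_thetaD => /eqP.
  rewrite -{1}[ordD w]add0n eqn_add2r /ordT (bigD1 i) //= ffunE eqxx.
  by [].
right; split.
  by case: sh => [[<- _]|[uw _]] //; apply: ltn_trans wd.
exists q; split=> [|y wy].
  exact: (eq_trans E (congr1 (fun s => s * _ + q) (shape_pderivv sh))).
apply: Hq; first by apply: (shape_above sh); apply: leq_trans wy.
move=> x xp xw; have xw' : (nu x < nu w)%N.
  rewrite ltn_neqAle; apply/andP; split; first by apply: contra xw => /eqP /nu_inj ->.
  rewrite leqNgt; apply/negP => wx; move: xp.
  by rewrite mem_vars (shape_above sh wx).
apply: contraTneq wy => <-; rewrite -ltnNge.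
exact: nu_thetaD.
Qed.

Let shape_iter i n w p : shape w p ->
  shape (iter n (thetaD (deltaT i)) w) (iter n (dderiv delta i) p).
Proof. by move=> sh; elim: n => [//|n IH]; rewrite !iterS; apply: shape_step. Qed.

Let thetaD_iter i n w : iter n (thetaD (deltaT i)) w =
  (w.1, [ffun j => (w.2 j + n * (j == i))%N]) :> T.
Proof.
elim: n => [|n IH].
  by case: w => j t; congr (_, _); apply/ffunP => j'; rewrite ffunE addn0.
rewrite iterS IH; congr (_, _); apply/ffunP => j; rewrite !ffunE /=.
by rewrite mulSn addnCA.
Qed.

Lemma dapply_shape t : thetaD t u != u -> exists q,
  dapply delta t f = pderivv u f * dvar k (thetaD t u) + q /\
  forall y, (nu (thetaD t u) <= nu y)%N -> degv y q = 0%N.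
Proof.
move=> tu; suff : shape (thetaD t u) (dapply delta t f).
  by case=> [[E _]|[_ //]]; rewrite E eqxx in tu.
(* Induction over the list [s] of derivations applied so far; the exponent [t j] counts only once
   [j] belongs to [s]. *)
have sh s : uniq s -> shape (u.1, [ffun j => (u.2 j + t j * (j \in s))%N])
    (foldr (fun i q => iter (t i) (dderiv delta i) q) f s).
  elim: s => [_|i s IH /= /andP[is_ us]].
    left; split=> //; case: (u) => j t'; congr (_, _); apply/ffunP => j'.
    by rewrite ffunE muln0 addn0.
  have := shape_iter i (t i) (IH us); rewrite thetaD_iter /=.
  congr (shape (_, _) _); apply/ffunP => j; rewrite !ffunE inE -addnA; congr (_ + _)%N.
  by case: eqP => [->|_]; rewrite ?(negbTE is_) ?muln0 ?muln1 ?addn0 ?add0n.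
have := sh _ (enum_uniq 'I_m); congr (shape (_, _) _); apply/ffunP => j.
by rewrite !ffunE mem_enum muln1 addnC.
Qed.

End Shape.

Lemma dapply0 f : dapply delta [ffun => 0%N] f = f.
Proof. by rewrite /dapply; elim: (enum _) => //= i s ->; rewrite ffunE. Qed.

Lemma thetaD_eq t u : thetaD t u = u -> t = [ffun => 0%N].
Proof.
case: u => j s [/ffunP E]; apply/ffunP => i; have := E i; rewrite !ffunE => /eqP.
by rewrite -{2}[s i]add0n eqn_add2r => /eqP.
Qed.

(* The chosen derivative of an element of A having leader w, together with its
   degree in w and the corresponding leading coefficient. *)
Definition gen A w : option (nat * R * R) :=
  if [seq c <- A | if leader c is Some u then below u w else false] is c :: _ then
    if leader c is Some u then
      if u == w then Some (degv u c, initial rk c, c)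
      else Some (1%N, separant rk c, dapply delta (quotT u w) c)
    else None
  else None.

Lemma genP A w e a g : gen A w = Some (e, a, g) -> exists c u,
  [/\ c \in A, leader c = Some u, below u w, g = dapply delta (quotT u w) c &
    if u == w then e = degv u c /\ a = initial rk c else e = 1%N /\ a = separant rk c].
Proof.
rewrite /gen; case E: [seq c <- A | _] => [//|c s].
have : c \in [seq c <- A | if leader c is Some u then below u w else false].
  by rewrite E mem_head.
rewrite mem_filter => /andP[]; case cu: (leader c) => [u|//] uw cA.
case: (eqVneq u w) => [uw'|uw'] [<- <- <-]; exists c, u; split=> //.
- rewrite -uw' -{1}[c](dapply0 c); congr dapply.
  by apply/ffunP => i; rewrite !ffunE subnn.
- by rewrite uw' eqxx.
- by rewrite (negbTE uw').
Qed.

Lemma gen_below A c u w : c \in A -> leader c = Some u -> below u w ->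
  exists e a g, gen A w = Some (e, a, g).
Proof.
move=> cA cu uw; rewrite /gen; case E: [seq c <- A | _] => [|c' s].
  have : c \in [seq c <- A | if leader c is Some u then below u w else false].
    by rewrite mem_filter cu uw.
  by rewrite E.
have : c' \in [seq c <- A | if leader c is Some u then below u w else false].
  by rewrite E mem_head.
rewrite mem_filter => /andP[]; case cu': (leader c') => [u'|//] _ _.
by case: eqP => _; eexists; eexists; eexists.
Qed.

Lemma HA_factor V A c : (forall c', c' \in A -> supp_in PL V c') -> c \in A ->
  exists b, supp_in PL V b /\ HA rk A = initial rk c * separant rk c * b.
Proof.
move=> VA cA; exists (HA rk (rem c A)); split; last by rewrite /HA (big_rem _ cA).
rewrite /HA big_seq; apply: big_ind => [|p q|c' c'A]; first exact: supp_in1.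
  exact: supp_inM.
have {}c'A := VA _ (mem_rem c'A).
rewrite /initial /separant; case: (leader c') => [u|]; apply: supp_inM; try exact: supp_in1.
  move=> x /c'A /= xc; apply/eqP; rewrite -leqn0.
  by apply: leq_trans (degv_lcoefv_le _ _ _) _; rewrite xc.
move=> x /c'A /= xc; apply/eqP; rewrite -leqn0.
by apply: leq_trans (degv_pderivv _ _ _) _; rewrite xc.
Qed.

Lemma supp_initial V c : supp_in PL V c -> supp_in PL V (initial rk c).
Proof.
move=> cV; rewrite /initial; case: (leader c) => [u|]; last exact: supp_in1.
move=> x /cV /= xc; apply/eqP; rewrite -leqn0.
by apply: leq_trans (degv_lcoefv_le _ _ _) _; rewrite xc.
Qed.

Lemma supp_separant V c : supp_in PL V c -> supp_in PL V (separant rk c).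
Proof.
move=> cV; rewrite /separant; case: (leader c) => [u|]; last exact: supp_in1.
move=> x /cV /= xc; apply/eqP; rewrite -leqn0.
by apply: leq_trans (degv_pderivv _ _ _) _; rewrite xc.
Qed.

Lemma mulr_assoc3 (S : comRingType) (a b c : S) : a * (b * c) = a * b * c.
Proof. by rewrite mulrA. Qed.

Lemma mulr_swap3 (S : comRingType) (a b c : S) : b * (a * c) = a * b * c.
Proof. by rewrite mulrCA mulrA. Qed.

Lemma divides_HA V A c : (forall c', c' \in A -> supp_in PL V c') -> c \in A ->
  divides_power PL V (HA rk A) (initial rk c) /\ divides_power PL V (HA rk A) (separant rk c).
Proof.
move=> VA cA; have [b [Vb E]] := HA_factor VA cA.
split.
  exists 1%N, (separant rk c * b); split.
    by apply: supp_inM => //; apply: supp_separant; apply: VA.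
  exact: (eq_trans (mulr_assoc3 _ _ _) (esym E)).
exists 1%N, (initial rk c * b); split.
  by apply: supp_inM => //; apply: supp_initial; apply: VA.
exact: (eq_trans (mulr_swap3 _ _ _) (esym E)).
Qed.

(** At the leader of the chosen element, the leading coefficient is its initial. At a proper
    derivative, linearity makes the separant both leading coefficient and partial derivative. All of
    these divide [HA rk A]. *)
Lemma gen_good V A : (forall c, c \in A -> supp_in PL V c) ->
  good_family PL nu V (HA rk A) (gen A).
Proof.
move=> VA w e a g /genP[c [u [cA cu uw -> H]]].
have [u0 cx] := (leaderP c u).1 cu.
have [Hi Hs] := divides_HA VA cA.
have sE := separantE cu; have iE := initialE cu.
have wE := thetaD_quot uw.
case: (eqVneq u w) H => [uw'|uw'] [-> ->].
  have -> : quotT u w = [ffun => 0%N].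
    by apply: (@thetaD_eq _ u); rewrite -wE uw'.
  rewrite dapply0 -uw'; split; [exact: u0 | | | exact: Hi | ].
  - have [r [cE rw _]] := lcoefv_split u c.
    by exists r; [rewrite iE; exact: cE | exact: rw u0].
  - split; first by rewrite iE; exact: lcoefv_free.
    move=> x ux; split; last exact: cx.
    apply/eqP; rewrite -leqn0 iE; apply: leq_trans (degv_lcoefv_le _ _ _) _.
    by rewrite cx.
  - by rewrite -[pdiff _ _ _]sE; exact: Hs.
have uw2 : (nu u < nu w)%N by apply: nu_proper; rewrite proper_derivativeE uw.
have ne : thetaD (quotT u w) u != u by rewrite -wE eq_sym.
have [q [gE Hq]] := dapply_shape cu ne; rewrite -wE in gE Hq.
have sx x : (nu u < nu x)%N -> degv x (separant rk c) = 0%N.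
  move=> ux; rewrite sE; apply/eqP; rewrite -leqn0; apply: leq_trans (degv_pderivv _ _ _) _.
  by rewrite cx.
rewrite gE -sE; split; [exact: isT | | | exact: Hs | ].
- exists q; last by rewrite [pdeg _ _ _]Hq.
  exact: (@linear_expr1 R (separant rk c) (dvar k w) q).
- split; first exact: sx.
  move=> x wx; split; first by apply: sx; apply: ltn_trans wx.
  apply: (@pdegD0 _ _ PL); last by apply: Hq; apply: ltnW.
  apply: (@pdegM0 _ _ PL); first by apply: sx; apply: ltn_trans wx.
  by rewrite /= degv_dvar; case: eqP => // E; rewrite E ltnn in wx.
have HD := @generator_deriv _ _ PL w _ q (sx _ uw2) (Hq _ (leqnn _)) (pderivv_dvar k w).
by rewrite [pdiff _ _ _]HD; exact: Hs.
Qed.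

End Generators.

Definition lexlt (a b : nat * nat) : bool :=
  (a.1 < b.1)%N || ((a.1 == b.1) && (a.2 < b.2)%N).

Lemma lexlt_irr : irreflexive lexlt.
Proof. by move=> [a b]; rewrite /lexlt /= !ltnn andbF. Qed.

Lemma lexlt_trans : transitive lexlt.
Proof. move=> [a b] [c d] [e f]; rewrite /lexlt /=; lia. Qed.

Lemma lexlt_total a b : [|| lexlt a b, a == b | lexlt b a].
Proof. case: a b => [a b] [c d]; rewrite /lexlt /= xpair_eqE; lia. Qed.

(** * Autoreduced and characteristic sets *)

Section Autoreduced.
Variables (k : fieldType) (m l : nat) (delta : 'I_m -> k -> k).
Local Notation T := (Der m l).
Local Notation R := (DPoly k m l).
Variables (rk : rel T) (nu : T -> nat).
Hypotheses (rk_ranking : is_ranking rk) (rk_orderly : is_orderly rk).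
Hypotheses (nu_inj : injective nu) (rkE : forall u v, rk u v = (nu u <= nu v)%N).
Local Notation leader := (leader rk).
Local Notation rank_lt := (rank_lt rk).
Local Notation rank_eq := (rank_eq rk).
Local Notation aut_lt := (aut_lt rk).
Local Notation gen := (gen delta rk).
Implicit Types (p q c f g r : R) (u v w x y : T) (A B C : seq R) (red : R -> R -> bool).

(** Ranks become pairs under the lexicographic order. The default [(0, 0)] is never the key of a
    nonconstant polynomial, whose degree in its leader is positive. *)
Definition rkey p : nat * nat := if leader p is Some u then (nu u, degv u p) else (0, 0)%N.

Lemma rank_ltK f g : notin_k f -> notin_k g -> rank_lt f g = lexlt (rkey f) (rkey g).
Proof.
move=> /(leader_notin_k rkE)[u fu] /(leader_notin_k rkE)[v gv].
rewrite /Defs.rank_lt /rkey fu gv /lexlt /= rkE (inj_eq nu_inj).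
by rewrite [(nu u < nu v)%N]ltn_neqAle (inj_eq nu_inj) andbC.
Qed.

Lemma rank_eqK f g : notin_k f -> notin_k g -> rank_eq f g = (rkey f == rkey g).
Proof.
move=> /(leader_notin_k rkE)[u fu] /(leader_notin_k rkE)[v gv].
by rewrite /Defs.rank_eq /rkey fu gv xpair_eqE (inj_eq nu_inj).
Qed.

Lemma leaderK f g u : leader f = Some u -> notin_k g -> (rkey g).1 = nu u -> leader g = Some u.
Proof.
move=> fu /(leader_notin_k rkE)[v gv]; rewrite /rkey gv /= => /nu_inj <-.
by [].
Qed.

(** In contrapositive form: not being lower is transitive. This carries minimality from one set over
    to another. *)
Lemma aut_lt_cotrans A B C : all (@notin_k k m l) A -> all (@notin_k k m l) B ->
  all (@notin_k k m l) C -> aut_lt A C -> aut_lt A B || aut_lt B C.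
Proof.
elim: A B C => [|a A IH] B C; first by case: C.
case: C => [|c C]; first by case: B => [|b B] *; rewrite /= ?orbT.
case: B => [//|b B] /= /andP[a0 A0] /andP[b0 B0] /andP[c0 C0].
rewrite !rank_ltK ?rank_eqK //.
have := IH B C A0 B0 C0; have := lexlt_total (rkey a) (rkey b).
case/or3P => [->|/eqP ->|ba] //.
  by rewrite lexlt_irr eqxx /=; case: (lexlt _ _); rewrite ?orbT //=; case: eqP.
move=> _ /orP[ac|/andP[/eqP <- _]]; last by rewrite ba orbT.
by rewrite (lexlt_trans ba ac) orbT.
Qed.

Lemma eq_aut_lt A B C : all (@notin_k k m l) A -> all (@notin_k k m l) B ->
  all (@notin_k k m l) C -> map rkey A = map rkey B -> aut_lt C A = aut_lt C B.
Proof.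
elim: A B C => [|a A IH] [|b B] [|c C] //= /andP[a0 A0] /andP[b0 B0] /andP[c0 C0] [ab AB].
by rewrite !rank_ltK ?rank_eqK // ab (IH B C).
Qed.

Lemma rank_lt_notin_k f g : rank_lt f g -> notin_k f /\ notin_k g.
Proof.
rewrite /Defs.rank_lt; case fu: (leader f) => [u|//]; case gv: (leader g) => [v|//] _.
by split; [apply: (leader_Some_notin_k rkE fu) | apply: (leader_Some_notin_k rkE gv)].
Qed.

Lemma rank_lt_trans : transitive (rank_lt : rel R).
Proof.
move=> g f h fg gh; have [[f0 g0] [_ h0]] := (rank_lt_notin_k fg, rank_lt_notin_k gh).
by move: fg gh; rewrite !rank_ltK //; apply: lexlt_trans.
Qed.

Lemma rank_lt_irr : irreflexive (rank_lt : rel R).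
Proof.
move=> f; apply/negP => ff; have [f0 _] := rank_lt_notin_k ff.
by move: ff; rewrite rank_ltK // lexlt_irr.
Qed.

Lemma autoreduced_red red A c c' : autoreduced_wrt rk red A ->
  c \in A -> c' \in A -> c != c' -> red c c'.
Proof.
move=> [_ _ H] cA c'A ne; have := H (index c A) (index c' A).
rewrite !index_mem cA c'A !nth_index //; apply=> //.
by apply: contra ne => /eqP E; rewrite -(nth_index 0 cA) E nth_index.
Qed.

Lemma autoreduced_notin_k red A c : autoreduced_wrt rk red A -> c \in A -> notin_k c.
Proof. by move=> [/allP H _ _] /H. Qed.

Lemma autoreducedI red A : all (@notin_k k m l) A -> sorted rank_lt A ->
  (forall c c', c \in A -> c' \in A -> c != c' -> red c c') -> autoreduced_wrt rk red A.
Proof.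
move=> A0 As H; split=> // i j iA jA ij; apply: H; rewrite ?mem_nth //.
by rewrite nth_uniq //; apply: sorted_uniq As; [exact: rank_lt_trans | exact: rank_lt_irr].
Qed.

Lemma areducedE f g u : leader g = Some u -> areduced rk f g = (degv u f < degv u g)%N.
Proof. by rewrite /areduced => ->. Qed.

Lemma dreducedE f g u : leader g = Some u -> dreduced rk f g =
  all (fun v => ~~ proper_derivative u v) (vars f) && (degv u f < degv u g)%N.
Proof. by rewrite /dreduced => ->. Qed.

Lemma dreduced_areduced f g : dreduced rk f g -> areduced rk f g.
Proof. by rewrite /dreduced /areduced; case: (leader g) => // u /andP[]. Qed.

(** Of two distinct elements with the same leader, each would have smaller degree than the other. *)
Lemma autoreduced_leader red A c c' u : (forall f g, red f g -> areduced rk f g) ->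
  autoreduced_wrt rk red A -> c \in A -> c' \in A ->
  leader c = Some u -> leader c' = Some u -> c = c'.
Proof.
move=> redA Aaut cA c'A cu c'u; case: (eqVneq c c') => // ne.
have := redA _ _ (autoreduced_red Aaut cA c'A ne).
rewrite eq_sym in ne; have := redA _ _ (autoreduced_red Aaut c'A cA ne).
by rewrite (areducedE _ cu) (areducedE _ c'u) ltnNge => /negbTE cc /ltnW; rewrite cc.
Qed.

Lemma rank_lt_areduced f g : rank_lt f g -> areduced rk f g.
Proof.
rewrite /Defs.rank_lt; case fu: (leader f) => [u|//]; case gv: (leader g) => [v|//].
rewrite (areducedE _ gv) rkE => /orP[/andP[uv ne]|/andP[/eqP <-]] //.
have [g0 _] := (leaderP nu_inj rkE g v).1 gv.
have [_ ->] := (leaderP nu_inj rkE f u).1 fu => //.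
by rewrite ltn_neqAle uv andbT; apply: contra ne => /eqP /nu_inj ->.
Qed.

Lemma rank_lt_dreduced f g : rank_lt f g -> dreduced rk f g.
Proof.
move=> fg; have := rank_lt_areduced fg; move: fg.
rewrite /Defs.rank_lt; case fu: (leader f) => [u|//]; case gv: (leader g) => [v|//].
rewrite (areducedE _ gv) (dreducedE _ gv) rkE => uv ->; rewrite andbT.
apply/allP => x; have := leader_spec rkE f; rewrite fu => -[_ H] /H xu.
apply/negP => /(nu_proper rk_ranking nu_inj rkE); rewrite ltnNge; case/negP.
apply: leq_trans xu _; case/orP: uv => [/andP[]|/andP[/eqP ->]] //.
Qed.

(* A reduced element of J could be inserted in its place in the ranking and
   would yield an autoreduced subset of lower rank. *)
Lemma charset_irreducible red (J : R -> Prop) A r :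
  (forall f g, red f g -> areduced rk f g) ->
  (forall f g, rank_lt f g -> red f g) ->
  autoreduced_wrt rk red A -> Defs.subsetP A J ->
  (forall B, autoreduced_wrt rk red B -> Defs.subsetP B J -> ~~ aut_lt B A) ->
  J r -> notin_k r -> (forall c, c \in A -> red r c) -> False.
Proof.
move=> redA ltred Aaut AJ Amin Jr r0 rA.
have [A0 As _] := Aaut.
pose B := rcons [seq c <- A | rank_lt c r] r.
have memB c : c \in B -> c = r \/ (c \in A /\ rank_lt c r).
  rewrite mem_rcons inE mem_filter => /orP[/eqP ->|/andP[cr cA]]; first by left.
  by right.
have Baut : autoreduced_wrt rk red B.
  apply: autoreducedI.
  - by apply/allP => c /memB[->//|[/(autoreduced_notin_k Aaut)]].
  - rewrite (sorted_pairwise rank_lt_trans) pairwise_rcons; apply/andP; split.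
      by apply/allP => c; rewrite mem_filter => /andP[].
    rewrite -(sorted_pairwise rank_lt_trans).
    exact: (sorted_filter rank_lt_trans).
  - move=> c c' /memB[->|[cA cr]] /memB[->|[c'A c'r]] ne.
    + by rewrite eqxx in ne.
    + exact: rA.
    + exact: ltred.
    + exact: (autoreduced_red Aaut).
have BJ : Defs.subsetP B J by move=> c /memB[->//|[/AJ]].
move/negP: (Amin B Baut BJ); apply.
(* Equal rank is impossible, as [r] is reduced with respect to [c]. *)
have rlt c : c \in A -> ~~ rank_lt c r -> rank_lt r c.
  move=> cA; have c0 := autoreduced_notin_k Aaut cA.
  rewrite !rank_ltK //; case/or3P: (lexlt_total (rkey r) (rkey c)) => [->|/eqP E|->] //.
  have := redA _ _ (rA c cA); have [u cu] := leader_notin_k rkE c0.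
  have E1 : (rkey r).1 = nu u by rewrite E /rkey cu.
  have ru := leaderK cu r0 E1.
  by rewrite (areducedE _ cu); move: E; rewrite /rkey ru cu => -[->]; rewrite ltnn.
rewrite /B; elim: (A) A0 rlt => [//|a s IH] /= /andP[a0 s0] rlt.
have IH' := IH s0 (fun c cs => rlt c (mem_behead (s := a :: s) cs)).
case: (boolP (rank_lt a r)) => ar /=.
  by rewrite (rank_eqK a0 a0) eqxx IH' orbT.
have ra := rlt a (mem_head _ _) ar.
(* The element compared with [a] is either [r] or some [b] below [r], and both rank below [a]. *)
case E: [seq c <- s | rank_lt c r] => [|b s'] /=; first by rewrite ra.
have : b \in [seq c <- s | rank_lt c r] by rewrite E mem_head.
by rewrite mem_filter => /andP[br _]; rewrite (rank_lt_trans br ra).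
Qed.

Lemma kolchin_irreducible J A r : kolchin_charset rk J A ->
  J r -> notin_k r -> (forall c, c \in A -> dreduced rk r c) -> False.
Proof.
by move=> [Aaut AJ Amin]; apply: charset_irreducible dreduced_areduced rank_lt_dreduced Aaut AJ Amin.
Qed.

Lemma alg_irreducible J A r : alg_charset rk J A ->
  J r -> notin_k r -> (forall c, c \in A -> areduced rk r c) -> False.
Proof.
move=> [Aaut AJ Amin].
exact: (charset_irreducible (fun f g H => H) rank_lt_areduced Aaut AJ Amin).
Qed.

Lemma sorted_rkey A : all (@notin_k k m l) A -> sorted rank_lt A -> sorted lexlt (map rkey A).
Proof.
move=> A0; rewrite sorted_map.
by apply: sub_in_sorted A0 => f g f0 g0 fg; rewrite /= -rank_ltK.
Qed.

Lemma leader_vars c u : leader c = Some u -> u \in vars c.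
Proof. by move=> cu; have := leader_spec rkE c; rewrite cu => -[]. Qed.

(** If [gen] selected an element other than [c] at [u], then [u] would be its leader or a proper
    derivative of its leader; autoreducedness excludes both. *)
Lemma gen_exact A c u : dautoreduced rk A -> c \in A -> leader c = Some u ->
  exists a g, gen A u = Some (degv u c, a, g).
Proof.
move=> Aaut cA cu.
have [e [a [g E]]] := gen_below delta cA cu (below_refl u).
exists a, g; rewrite E; have [c' [u' [c'A c'u' u'u _ H]]] := genP E.
case: (eqVneq u' u) H c'u' => [-> [-> _]|ne _] c'u'.
  by rewrite (autoreduced_leader dreduced_areduced Aaut cA c'A cu c'u').
have cc' : c != c' by apply: contra_neq ne => E'; move: c'u'; rewrite -E' cu => -[].
have := autoreduced_red Aaut cA c'A cc'.
rewrite (dreducedE _ c'u') => /andP[/allP /(_ _ (leader_vars cu))].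
by rewrite proper_derivativeE u'u ne.
Qed.

(** The degree could differ from 1 only if some element had leader [w]; it would not be reduced with
    respect to [c]. *)
Lemma gen_proper A c u w : dautoreduced rk A -> c \in A -> leader c = Some u ->
  proper_derivative u w -> exists a g, gen A w = Some (1%N, a, g).
Proof.
move=> Aaut cA cu; rewrite proper_derivativeE => /andP[uw ne].
have [e [a [g E]]] := gen_below delta cA cu uw.
exists a, g; rewrite E; have [c' [u' [c'A c'u' u'w _ H]]] := genP E.
case: (eqVneq u' w) H c'u' => [-> _|_ [-> _]] // c'w.
have cc' : c' != c by apply: contra_neq ne => E'; move: c'w; rewrite E' cu => -[].
have := autoreduced_red Aaut c'A cA cc'.
rewrite (dreducedE _ cu) => /andP[/allP /(_ _ (leader_vars c'w))].
by rewrite proper_derivativeE uw ne.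
Qed.

(** At a proper derivative of a leader the generator has degree 1, so the bound there says that the
    derivative is absent from [r]. *)
Lemma gen_dreduced A r : dautoreduced rk A ->
  (forall w e a g, gen A w = Some (e, a, g) -> (degv w r < e)%N) ->
  forall c, c \in A -> dreduced rk r c.
Proof.
move=> Aaut H c cA; have [u cu] := leader_notin_k rkE (autoreduced_notin_k Aaut cA).
rewrite (dreducedE _ cu); have [a [g /H ->]] := gen_exact Aaut cA cu.
rewrite andbT; apply/allP => w; rewrite mem_vars => wr; apply/negP => uw.
have [a' [g' /H]] := gen_proper Aaut cA cu uw.
by rewrite ltnS leqn0 (negbTE wr).
Qed.

End Autoreduced.

Lemma ideal_sub (S : comRingType) (J : S -> Prop) (a b : S) :
  (forall a b, J a -> J b -> J (a + b)) -> (forall a b, J b -> J (a * b)) ->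
  J a -> J (a - b) -> J b.
Proof.
move=> JD JM Ja Jab; have -> : b = a + (-1) * (a - b) by ring.
by apply: JD => //; apply: JM.
Qed.

(** * Ideals with a given characteristic set *)

Section CharSets.
Variables (k : fieldType) (m l : nat) (delta : 'I_m -> k -> k).
Local Notation T := (Der m l).
Local Notation R := (DPoly k m l).
Local Notation PL := (dpoly_like k m l).
Variables (rk : rel T) (nu : T -> nat).
Hypotheses (rk_ranking : is_ranking rk) (rk_orderly : is_orderly rk).
Hypotheses (nu_inj : injective nu) (rkE : forall u v, rk u v = (nu u <= nu v)%N).
Local Notation leader := (leader rk).
Local Notation gen := (gen delta rk).
Implicit Types (p q c f g r : R) (u v w x y : T) (t : Theta m) (A : seq R) (J : R -> Prop).

Lemma dapply_closed J t f : (forall i a, J a -> J (dderiv delta i a)) -> J f -> J (dapply delta t f).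
Proof.
move=> JD Jf; rewrite /dapply; elim: (enum _) => [//|i s IH] /=.
by elim: (t i) => [//|n IHn] /=; apply: JD.
Qed.

Lemma gen_closed J A w e a g : is_radical_dideal delta J -> Defs.subsetP A J ->
  gen A w = Some (e, a, g) -> J g.
Proof.
by move=> [_ _ _ JD _] AJ /genP[c [u [/AJ Jc _ _ -> _]]]; apply: dapply_closed.
Qed.

Lemma eq_mul1r (S : comRingType) (x : S) : x = 1 * x.
Proof. by rewrite mul1r. Qed.

Lemma gen_dideal A w e a g : gen A w = Some (e, a, g) -> dideal delta A g.
Proof.
move=> /genP[c [u [cA _ _ -> _]]]; exists [:: (1, quotT u w, c)]; split.
  by move=> t; rewrite inE => /eqP ->.
by rewrite big_seq1; apply: eq_mul1r.
Qed.

Lemma dideal0 A : dideal delta A 0.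
Proof. by exists [::]; split => //; rewrite big_nil. Qed.

Lemma didealD A p q : dideal delta A p -> dideal delta A q -> dideal delta A (p + q).
Proof.
move=> [s [Hs ->]] [t [Ht ->]]; exists (s ++ t); split; last by rewrite big_cat.
by move=> u; rewrite mem_cat => /orP[/Hs|/Ht].
Qed.

Lemma didealM A p q : dideal delta A q -> dideal delta A (p * q).
Proof.
move=> [s [Hs ->]]; exists [seq (p * z.1.1, z.1.2, z.2) | z <- s]; split.
  by move=> _ /mapP[t /Hs H ->].
rewrite big_map mulr_sumr; apply: eq_bigr => t _.
exact: mulrA.
Qed.

Lemma idl_dideal V A N p : idl PL V (gens nu (gen A) V N) p -> dideal delta A p.
Proof.
apply: idl_sub; [exact: dideal0 | exact: didealD | exact: didealM |].
by move=> g [w [e [a [_ _ /gen_dideal]]]].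
Qed.

Lemma vars_bound p : exists N, forall x, (degv x p != 0)%N -> (nu x < N)%N.
Proof.
exists (\max_(x <- vars p) nu x).+1 => x; rewrite -mem_vars ltnS => xp.
exact: leq_bigmax_seq.
Qed.

Lemma const_unit J (c : k) : (forall a b, J b -> J (a * b)) -> c != 0 -> J (c%:MP : R) -> J 1.
Proof.
move=> JM c0 Jc; have := JM (c^-1)%:MP _ Jc.
by rewrite -mpolyCM mulVf // mpolyC1E.
Qed.

(** The remainder lies in [J] and is reduced with respect to [A], so minimality of [A] makes it
    constant, and it is zero because 1 is not in [J]. The bound [N] allows reducing by the low
    generators only, with a multiplier free of all variables from [N] on. *)
Lemma charset_reduces_to_zero (V : pred T) J A p N :
  is_radical_dideal delta J -> kolchin_charset rk J A -> ~ J 1 -> J p ->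
  (forall x w, V w -> (nu x <= nu w)%N -> V x) -> supp_in PL V p ->
  (forall c, c \in A -> supp_in PL V c) ->
  (forall x, (degv x p != 0)%N -> (nu x < N)%N \/ gen A x = None) ->
  exists s, [/\ divides_power PL V (HA rk A) s,
    (forall x, (N <= nu x)%N -> degv x s = 0%N) & idl PL V (gens nu (gen A) V N) (s * p)].
Proof.
move=> radJ chA J1 Jp Vdown Vp VA pN.
have [J0 JD JM _ _] := radJ; have [Aaut AJ _] := chA.
have gG := gen_good (delta := delta) rk_ranking nu_inj rkE VA.
have [s [r [[Hs Vs] sx sp rw [Vr rx]]]] := pseudo_reduction nu_inj N gG Vdown Vp.
have Jsp : J (s * p - r).
  apply: idl_sub sp => // g [w [e [a [_ _]]]]; exact: gen_closed.
have Jr : J r by apply: ideal_sub Jsp => //; apply: JM.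
have red c : c \in A -> dreduced rk r c.
  apply: (gen_dreduced (delta := delta) rkE Aaut) => w e a g Gw.
  case: (ltnP (nu w) N) => wN; first exact: rw Gw.
  (* From index [N] on, [p] contains no variable carrying a generator, and the reduction does not
     raise degrees there. *)
  have [e0 _ _ _ _] := gG _ _ _ _ Gw.
  have rxw : (degv w r <= degv w p)%N := rx w wN.
  apply: leq_ltn_trans rxw _; case: (posnP (degv w p)) => [->|] //.
  by rewrite lt0n => /pN[|]; [rewrite ltnNge wN | rewrite Gw].
exists s; split=> //.
have r0 : r = 0.
  case: (boolP (notin_k r)) => [rk0|].
    by case: (kolchin_irreducible rk_ranking nu_inj rkE chA Jr rk0 red).
  rewrite negbK => /constP[c rE]; case: (eqVneq c 0) => [c0|c0].
    by rewrite rE c0 malgC0E.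
  by case: J1; rewrite rE in Jr; apply: const_unit Jr.
by move: sp; rewrite r0 subr0.
Qed.

Lemma ne_dreduced f c u : leader c = Some u -> ~~ dreduced rk f c ->
  (exists2 v, v \in vars f & proper_derivative u v) \/ (degv u c <= degv u f)%N.
Proof.
move=> cu; rewrite (dreducedE _ cu) negb_and -leqNgt => /orP[/allPn[v vf]|]; last by right.
by rewrite negbK => uv; left; exists v.
Qed.

Lemma evalp_linear (e : T -> k) (c : k) x q :
  evalp e (c%:MP * dvar k x + q) = c * e x + evalp e q.
Proof.
apply: (eq_trans (evalpD e _ _)); congr (_ + _).
apply: (eq_trans (evalpM e _ _)); congr (_ * _); first exact: evalpC.
exact: evalp_dvar.
Qed.

(** * Characteristic sets of the unit ideal *)

Section UnitIdeal.
Variables (J : R -> Prop) (A : seq R).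
Hypotheses (J_full : forall p, J p) (chA : kolchin_charset rk J A).

Let Aaut : dautoreduced rk A. Proof. by have [] := chA. Qed.

Let zeroT : Theta m := [ffun => 0%N].

Let indet_proper j x : x.1 = j -> x != (j, zeroT) -> proper_derivative (j, zeroT) x.
Proof.
move=> xj ne; rewrite proper_derivativeE eq_sym ne andbT /below xj eqxx.
by apply/forallP => i; rewrite ffunE.
Qed.

(** As y_j lies in [J], it fails to be reduced with respect to some element of [A]. Since y_j is not
    a proper derivative of anything, that element has leader y_j and degree at most 1. *)
Let leader_indet j : exists c, [/\ c \in A, leader c = Some (j, zeroT) & degv (j, zeroT) c = 1%N].
Proof.
set y := (j, zeroT).
have vy x : x \in vars (dvar k y) -> x = y.
  by rewrite mem_vars degv_dvar; case: (eqVneq y x) => [->|].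
have y0 : notin_k (dvar k y).
  have : y \in vars (dvar k y) by rewrite mem_vars degv_dvar eqxx.
  by rewrite /notin_k; apply: contraTneq => ->.
have /allPn[c cA Hc] : ~~ all (dreduced rk (dvar k y)) A.
  apply/negP => /allP H.
  exact: (kolchin_irreducible rk_ranking nu_inj rkE chA (J_full _) y0 H).
have [u cu] := leader_notin_k rkE (autoreduced_notin_k Aaut cA).
have [u0 _] := (leaderP nu_inj rkE c u).1 cu.
exists c; case: (ne_dreduced cu Hc) => [[v /vy ->]|].
  rewrite proper_derivativeE => /andP[/andP[/eqP uj /forallP Hu]] /eqP[].
  case: u uj Hu {cu u0} => j' t /= -> Hu; congr (_, _); apply/ffunP => i.
  by have := Hu i; rewrite !ffunE leqn0 => /eqP.
rewrite degv_dvar; case: (eqVneq y u) => [-> cu1|_]; last by rewrite leqNgt u0.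
split=> //; apply/eqP; rewrite eqn_leq; apply/andP; split; [exact: cu1 | exact: u0].
Qed.

(** Any variable of [c] other than its leader would be a proper derivative of some y_j, or a y_j
    that is the degree-one leader of another element. So [c] has the form a y_j + b with constants a
    and b. *)
Let elt_vars c x : c \in A -> x \in vars c ->
  [/\ leader c = Some x, degv x c = 1%N & x.2 = zeroT].
Proof.
move=> cA xc; have [c' [c'A c'u d1]] := leader_indet x.1.
case: (eqVneq x (x.1, zeroT)) => xE; last first.
  have px := indet_proper (erefl _) xE.
  case: (eqVneq c c') => cc'.
    have := leader_spec rkE c; rewrite cc' c'u => -[_ /(_ x)]; rewrite -cc' xc => /(_ isT).
    by rewrite leqNgt (nu_proper rk_ranking nu_inj rkE px).
  have := autoreduced_red Aaut cA c'A cc'.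
  by rewrite (dreducedE _ c'u) => /andP[/allP /(_ x xc)]; rewrite px.
case: (eqVneq c c') => cc'; first by rewrite cc' xE; split.
have := autoreduced_red Aaut cA c'A cc'.
rewrite (dreducedE _ c'u) d1 => /andP[_]; rewrite -xE ltnS leqn0.
by move: xc; rewrite mem_vars => /negbTE ->.
Qed.

Lemma const_of_free p : (forall x, degv x p = 0%N) -> exists c : k, p = c%:MP.
Proof.
move=> H; apply/constP; case E: (vars p) => [//|x s].
by have := mem_vars x p; rewrite E mem_head H.
Qed.

Let linear_elt c u : c \in A -> leader c = Some u -> exists a : k,
  [/\ a != 0, initial rk c = a%:MP & separant rk c = a%:MP].
Proof.
move=> cA cu; have uc := leader_vars rkE cu.
have [_ d1 _] := elt_vars cA uc.
have [r [cE rw rx]] := lcoefv_split u c.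
have cx x : x != u -> degv x c = 0%N.
  move=> xu; apply: degv_vars; apply: contra xu => /(elt_vars cA)[].
  by rewrite cu => -[->].
have r0 x : degv x r = 0%N.
  apply/eqP; rewrite -leqn0; case: (eqVneq x u) => [->|xu].
    by rewrite -ltnS -d1 rw // d1.
  by rewrite -(cx x xu) rx.
have [a aE] : exists a : k, lcoefv u c = a%:MP.
  apply: const_of_free => x; case: (eqVneq x u) => [->|xu]; first exact: lcoefv_free.
  by apply/eqP; rewrite -leqn0 -(cx x xu) degv_lcoefv_le.
have cE' : c = a%:MP * dvar k u + r.
  rewrite d1 aE in cE; exact: (eq_trans cE (esym (@linear_expr1 R _ _ _))).
exists a; split.
- apply/eqP => a0; move: d1; rewrite cE' a0 malgC0E.
  by rewrite [0 * _]mul0r add0r r0.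
- by rewrite (initialE cu).
rewrite (separantE cu) cE'.
apply: (@generator_deriv _ _ PL); [exact: degvC | exact: r0 | exact: pderivv_dvar].
Qed.

Let HA_const : exists2 h : k, h != 0 & HA rk A = h%:MP.
Proof.
rewrite /HA big_seq.
apply: (big_ind (fun p : R => exists2 h : k, h != 0 & p = h%:MP)) => [|p q|c cA].
- by exists 1; rewrite ?oner_eq0 ?mpolyC1E.
- by move=> [h h0 ->] [h' h'0 ->]; exists (h * h'); rewrite ?mulf_neq0 // mpolyCM.
have [u cu] := leader_notin_k rkE (autoreduced_notin_k Aaut cA).
have [a [a0 -> ->]] := linear_elt cA cu.
by exists (a * a); rewrite ?mulf_neq0 // mpolyCM.
Qed.

Let deriv_of w g := exists c u t,
  [/\ c \in A, leader c = Some u, w = thetaD t u & g = dapply delta t c].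

(** Each derivative is the leader of at most one equation, so the successive solution meets no
    integrability condition. *)
Let deriv_of_uniq w g g' : deriv_of w g -> deriv_of w g' -> g = g'.
Proof.
move=> [c [u [t [cA cu -> ->]]]] [c' [u' [t' [c'A c'u' E ->]]]].
have [_ _ u0] := elt_vars cA (leader_vars rkE cu).
have [_ _ u'0] := elt_vars c'A (leader_vars rkE c'u').
case: u u' cu u0 c'u' u'0 E => [j s] [j' s'] cu /= s0 c'u' s'0 [jj' /ffunP E].
rewrite s0 in cu E; rewrite s'0 -jj' in c'u' E.
have -> : t = t' by apply/ffunP => i; have := E i; rewrite !ffunE !addn0.
congr dapply.
exact: (autoreduced_leader (@dreduced_areduced _ _ _ rk) Aaut cA c'A cu c'u').
Qed.

Let deriv_of_linear w g : deriv_of w g -> exists (a : k) q,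
  [/\ a != 0, g = a%:MP * dvar k w + q & forall x, (nu w <= nu x)%N -> degv x q = 0%N].
Proof.
move=> [c [u [t [cA cu -> ->]]]]; have [a [a0 iE sE]] := linear_elt cA cu.
have uc := leader_vars rkE cu; have [_ d1 _] := elt_vars cA uc.
case: (eqVneq (thetaD t u) u) => [E|ne]; last first.
  have [q [E Hq]] := dapply_shape delta rk_ranking nu_inj rkE cu ne.
  exists a, q; split; [exact: a0 | | exact: Hq].
  by rewrite -sE (separantE cu); exact: E.
have [r [cE rw rx]] := lcoefv_split u c.
exists a, r; split; first exact: a0.
  rewrite d1 -(initialE cu) iE in cE; rewrite (thetaD_eq E) dapply0 -(thetaD_eq E) E.
  exact: (eq_trans cE (esym (@linear_expr1 R _ _ _))).
rewrite E => x ux; apply/eqP; rewrite -leqn0; case: (eqVneq x u) => [->|xu].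
  by rewrite -ltnS -d1 rw // d1.
have [_ cx] := (leaderP nu_inj rkE c u).1 cu.
rewrite -(cx x); first exact: rx.
by rewrite ltn_neqAle ux andbT; apply: contra xu => /eqP /nu_inj ->.
Qed.

(** Values are assigned in increasing order: the equation with leader [w] is linear in [w] with a
    nonzero constant coefficient, and earlier equations do not involve [w]. *)
Let common_zero N : exists e : T -> k,
  forall w g, (nu w < N)%N -> deriv_of w g -> evalp e g = 0.
Proof.
elim: N => [|N [e He]]; first by exists (fun _ => 0).
case: (classic (exists w g, nu w = N /\ deriv_of w g)) => [[w [g [wN wg]]]|no]; last first.
  exists e => w g; rewrite ltnS leq_eqVlt => /orP[/eqP wN|]; last exact: He.
  by move=> wg; case: no; exists w, g.
have [a [q [a0 gE Hq]]] := deriv_of_linear wg.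
pose e' x := if x == w then - evalp e q / a else e x.
have ee' p : (forall x, (N <= nu x)%N -> degv x p = 0%N) -> evalp e' p = evalp e p.
  move=> Hp; apply: eq_evalp => x xp; rewrite /e'; case: (eqVneq x w) => [E|//].
  by move: xp; rewrite E Hp ?wN.
exists e' => w' g'; rewrite ltnS leq_eqVlt => /orP[/eqP w'N|w'N] wg'.
  have E : w' = w by apply: nu_inj; rewrite wN.
  have E' : g' = g by apply: (@deriv_of_uniq w); [rewrite -E | ].
  rewrite {}E' {}gE; apply: (eq_trans (evalp_linear e' a w q)).
  have -> : evalp e' q = evalp e q by apply: ee'; rewrite -wN.
  by rewrite /e' eqxx mulrC divfK // addNr.
rewrite ee'; first exact: He wg'.
have [a' [q' [_ -> Hq']]] := deriv_of_linear wg'.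
move=> x Nx; apply: (@pdegD0 _ _ PL); last by apply: Hq'; rewrite (leq_trans _ Nx) // ltnW.
apply: (@pdegM0 _ _ PL); first exact: degvC.
rewrite [pdeg _ _ _]degv_dvar; case: eqP => // E.
by move: w'N; rewrite E ltnNge Nx.
Qed.

(** At a common zero of the derivatives involved, the combination vanishes, whereas [HA rk A] is a
    nonzero constant. *)
Lemma charset_unit_ideal : ~ saturate (dideal delta A) (HA rk A) 1.
Proof.
move=> [n [s [Hs E]]]; have [h h0 HE] := HA_const.
(* The combination has finitely many terms, so a zero up to the largest leader among them
   suffices. *)
pose nt (z : R * Theta m * R) := if leader z.2 is Some u then nu (thetaD z.1.2 u) else 0%N.
have [e He] := common_zero (\max_(z <- s) nt z).+1.
have : evalp e (HA rk A ^+ n * 1) = h ^+ n.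
  rewrite evalpM -mpolyC1E evalpC mulr1 HE; elim: (n) => [|i IH].
    by rewrite expr0 -mpolyC1E evalpC expr0.
  by rewrite exprS evalpM IH evalpC exprS.
have e0 : evalp e 0 = 0 by apply: mmap0.
rewrite E (big_morph (evalp e) (evalpD e) e0) big_seq big1.
  by move=> /esym /eqP; rewrite expf_eq0 (negbTE h0) andbF.
move=> t ts; rewrite evalpM; have tA := Hs _ ts.
have [u tu] := leader_notin_k rkE (autoreduced_notin_k Aaut tA).
have D : deriv_of (thetaD t.1.2 u) (dapply delta t.1.2 t.2).
  by exists t.2, u, t.1.2; split.
have L : (nu (thetaD t.1.2 u) < (\max_(z <- s) nt z).+1)%N.
  have -> : nu (thetaD t.1.2 u) = nt t by rewrite /nt tu.
  by rewrite ltnS; apply: leq_bigmax_seq.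
by rewrite (He _ _ L D) mulr0.
Qed.

Lemma charset_full_ordD c u : c \in A -> leader c = Some u -> ordD u = 0%N.
Proof.
move=> cA cu; have [_ _ u0] := elt_vars cA (leader_vars rkE cu).
by rewrite /ordD u0 /ordT big1 // => i _; rewrite ffunE.
Qed.

End UnitIdeal.

End CharSets.

(** * Identities for saturated ideals *)

Section SaturationIdentities.
Variables (S : comRingType) (J : S -> Prop).
Hypothesis JM : forall a b, J b -> J (a * b).

Lemma closed_mull a b : J a -> J (a * b).
Proof. by rewrite mulrC; apply: JM. Qed.

Lemma closed_mulAr a b c : J (a * b) -> J (a * (b * c)).
Proof. by move=> Jab; rewrite mulrA; apply: closed_mull. Qed.

Lemma closed_mulA3 a b c : J b -> J (a * b * c).
Proof. by move=> Jb; rewrite mulrC; apply: JM; apply: JM. Qed.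

Lemma saturate_cancel H e q : (exists n, J (H ^+ n * (H ^+ e * q))) -> exists n, J (H ^+ n * q).
Proof. by move=> [n Jn]; exists (n + e)%N; rewrite exprD -mulrA. Qed.

Lemma power_cofactor H e s b q : s * b = H ^+ e -> J (s * q) -> J (H ^+ e * q).
Proof. by move=> <- Jq; have -> : s * b * q = b * (s * q); [ring | apply: JM]. Qed.

Lemma power_cofactor_cancel H e s b q x : s * b = H ^+ e -> J (x * (q * s)) -> J (H ^+ e * (x * q)).
Proof.
by move=> <- Jq; have -> : s * b * (x * q) = b * (x * (q * s)); [ring | apply: JM].
Qed.

Lemma power_cofactor2 H e e' s b : s * b = H ^+ e -> J (H ^+ e' * s) -> J (H ^+ (e' + e) * 1).
Proof. by rewrite exprD => <- Js; rewrite mulr1 mulrA mulrC; apply: JM. Qed.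

Lemma power_product x y e : J (x ^+ e * y) -> J ((x * y) ^+ e.+1).
Proof.
move=> Jxy; have -> : (x * y) ^+ e.+1 = x * y ^+ e * (x ^+ e * y).
  by rewrite exprMn !exprS; ring.
exact: JM.
Qed.

Lemma closed_mulr1 x : J x -> J (x * 1).
Proof. by rewrite mulr1. Qed.

Lemma closed_mul1 x : J (x * 1) -> J x.
Proof. by rewrite mulr1. Qed.

End SaturationIdentities.

Lemma pdiff_mul_free (T : eqType) (S : comRingType) (PL : poly_like T S) v s p :
  pdeg PL v s = 0%N -> pdiff PL v (s * p) = s * pdiff PL v p.
Proof. by move=> s0; rewrite pdiffM (pdiff_free s0) mul0r add0r. Qed.

Lemma idl_cofactor (T : eqType) (S : comRingType) (PL : poly_like T S) V Gen H e s b p :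
  s * b = H ^+ e -> supp_in PL V b -> idl PL V Gen (s * p) -> idl PL V Gen (H ^+ e * p).
Proof.
by move=> <- Vb Hs; have -> : s * b * p = b * (s * p); [ring | apply: idlM].
Qed.

(** * Characteristic decompositions *)

Section Decomposition.
Variables (k : fieldType) (m l : nat) (delta : 'I_m -> k -> k).
Local Notation T := (Der m l).
Local Notation R := (DPoly k m l).
Local Notation PL := (dpoly_like k m l).
Variables (rk : rel T) (nu : T -> nat).
Hypotheses (rk_ranking : is_ranking rk) (rk_orderly : is_orderly rk).
Hypotheses (nu_inj : injective nu) (rkE : forall u v, rk u v = (nu u <= nu v)%N).
Local Notation leader := (leader rk).
Local Notation gen := (gen delta rk).
Implicit Types (p q c f g r : R) (u v w x y : T) (t : Theta m) (A : seq R).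

Variables (I : R -> Prop) (n : nat) (C : 'I_n -> seq R) (C0 : seq R).
Hypotheses (radI : is_radical_dideal delta I) (ch0 : kolchin_charset rk I C0).
Hypothesis consistent : ~ saturate (dideal delta C0) (HA rk C0) 1.
Hypothesis decI : char_decomposition delta rk I C.

Local Notation h := (max_order C).
Local Notation J i := (saturate (dideal delta (C i)) (HA rk (C i))).

Let IE p : I p <-> forall i, J i p. Proof. by case: decI. Qed.
Let radJ i : is_radical_dideal delta (J i). Proof. by case: decI => _ /(_ i) []. Qed.
Let chJ i : kolchin_charset rk (J i) (C i). Proof. by case: decI => _ /(_ i) []. Qed.

(** If it contained 1, the component would be the unit ideal while being the saturation by its own
    characteristic set. *)
Let J1 i : ~ J i 1.
Proof.
move=> Ji1; refine (charset_unit_ideal rk_ranking nu_inj rkE _ (chJ i) Ji1) => p.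
have [_ _ JM _ _] := radJ i.
exact: (@closed_mul1 R (J i) p (JM p 1 Ji1)).
Qed.

Let order_le v := (ordD v <= h)%N.

Let order_le_down x w : order_le w -> (nu x <= nu w)%N -> order_le x.
Proof. by move=> wh /(nu_ordD rk_ranking rk_orderly rkE) xw; apply: leq_trans xw wh. Qed.

Lemma in_RhP p : in_Rh h p <-> supp_in PL order_le p.
Proof. exact: vars_sub. Qed.

Let C_order i c : c \in C i -> supp_in PL order_le c.
Proof.
move=> cC; apply/in_RhP/allP => v vc; rewrite /max_order.
pose F f := (\max_(v <- vars f) ordD v)%N.
have H1 : (ordD v <= F c)%N by exact: leq_bigmax_seq.
have H2 : (F c <= \max_(f <- C i) F f)%N by exact: leq_bigmax_seq.
exact: leq_trans H1 (leq_trans H2 (leq_bigmax (F := fun i => (\max_(f <- C i) F f)%N) i)).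
Qed.

Let supp_predT p : supp_in PL predT p. Proof. by []. Qed.

Lemma Iprime_sub p : Iprime delta rk h C p -> I p.
Proof.
move=> [_ H]; apply/IE => i; have [e [s [Hs E]]] := H i.
exists e; rewrite E big_seq; apply: big_ind; [exact: dideal0 | exact: didealD |].
move=> z /Hs[_ [f [t [fC _ ->]]]]; apply: didealM; exists [:: (1, t, f)]; split.
  by move=> z'; rewrite inE => /eqP ->.
by rewrite big_seq1; apply: eq_mul1r.
Qed.

(** The ranking is orderly, so the derivatives of order at most [h] are closed downwards and the
    reduction of [p] by [C i] takes place entirely inside R_h. *)
Lemma sub_Iprime p : I p -> in_Rh h p -> Iprime delta rk h C p.
Proof.
move=> Ip ph; split=> // i; have [N HN] := vars_bound nu p.
have Jip : J i p by move: i; apply/IE.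
have bound x : (degv x p != 0)%N -> (nu x < N)%N \/ gen (C i) x = None.
  by move=> /HN; left.
have [s [[e [b [Vb E]]] _ Hs]] := charset_reduces_to_zero rk_ranking nu_inj rkE (radJ i)
  (chJ i) (@J1 i) Jip order_le_down ((in_RhP p).1 ph) (@C_order i) bound.
exists e; have {}Hs : idl PL order_le (gens nu (gen (C i)) order_le N) (HA rk (C i) ^+ e * p).
  exact: idl_cofactor E Vb Hs.
case: Hs => z [Hz Ez]; exists z; split; last exact: Ez.
move=> y /Hz[/in_RhP yh [w [e' [a [_ wh Gw]]]]]; split; first exact: yh.
have [c [u [cC cu uw -> _]]] := genP Gw.
exists c, (quotT u w); split; [exact: cC | | exact: erefl].
by rewrite cu -(thetaD_quot uw).
Qed.

(** * Exclusion of leaders of order greater than [h] *)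

Section LargeLeader.
Variables (c : R) (u : T).
Hypotheses (cC0 : c \in C0) (cu : leader c = Some u) (hu : (h < ordD u)%N).

Let H0 := HA rk C0.

(** A characteristic set of the unit ideal has only leaders of order 0, whereas [u] has order above
    [h]. *)
Let I1 : ~ I 1.
Proof.
have [_ _ IM _ _] := radI.
move=> Ione; have Ifull p : I p by exact: (@closed_mul1 R I p (IM p 1 Ione)).
by move: hu; rewrite (charset_full_ordD rk_ranking nu_inj rkE Ifull ch0 cC0 cu).
Qed.

Let gG0 := @gen_good k m l delta rk nu rk_ranking nu_inj rkE predT C0 (fun c' _ => @supp_predT c').

Let red0 p : I p -> exists s N,
  divides_power PL predT H0 s /\ idl PL predT (gens nu (gen C0) predT N) (s * p).
Proof.
move=> Ip; have [N HN] := vars_bound nu p.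
have bound x : (degv x p != 0)%N -> (nu x < N)%N \/ gen C0 x = None.
  by move=> /HN; left.
have [s [Hs _ Is]] := charset_reduces_to_zero (V := predT) rk_ranking nu_inj rkE radI ch0 I1 Ip
  (fun _ _ _ _ => isT) (@supp_predT p) (fun c' _ => @supp_predT c') bound.
exact: (ex_intro _ s (ex_intro _ N (conj Hs Is))).
Qed.

Let not_sat1 : ~ sat H0 I 1.
Proof.
move=> [e /red0[s [N [[e' [b [_ E]]] /idl_dideal Hs]]]]; apply: consistent.
apply: (@saturate_cancel R _ H0 e); exists e'.
exact: (power_cofactor (@didealM _ _ _ _ _) E Hs).
Qed.

(** Only generators below [u] are needed to reduce [c] to zero. They and the multiplier are free of
    [u], so differentiating with respect to [u] puts the separant of [c], a factor of [H0], into the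
    component. *)
Let H0_mem i : gen (C i) u = None -> J i H0.
Proof.
move=> Gu; have [_ cx] := (leaderP nu_inj rkE c u).1 cu.
have Jic : J i c by move: i {Gu}; apply/IE; have [_ CI _] := ch0; apply: CI.
have bound x : (degv x c != 0)%N -> (nu x < nu u)%N \/ gen (C i) x = None.
  case: (ltnP (nu u) (nu x)) => [/cx -> //|]; rewrite leq_eqVlt => /orP[/eqP/nu_inj ->|].
    by right.
  by left.
have [s [[e [b [_ E]]] su Hs]] := charset_reduces_to_zero (V := predT) rk_ranking nu_inj rkE
  (radJ i) (chJ i) (@J1 i) Jic (fun _ _ _ _ => isT) (@supp_predT c) (fun c' _ => @supp_predT c') bound.
have gfree g : gens nu (gen (C i)) predT (nu u) g -> pdeg PL u g = 0%N.
  move=> [w [e' [a [wu _ Gw]]]].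
  have [_ _ [_ gx] _ _] := @gen_good k m l delta rk nu rk_ranking nu_inj rkE predT (C i)
    (fun c' _ => @supp_predT c') _ _ _ _ Gw.
  by have [] := gx u wu.
have := idl_dideal (idl_pdiff gfree Hs).
rewrite (@pdiff_mul_free _ _ PL u s c (su u (leqnn _))) => HS.
have JS : J i (separant rk c).
  by exists e; rewrite (separantE cu); apply: (power_cofactor (@didealM _ _ _ _ _) E HS).
have [b' [_ HE]] := @HA_factor k m l rk predT C0 c (fun c' _ => @supp_predT c') cC0.
have [_ _ JM _ _] := radJ i.
by rewrite /H0 HE; apply: closed_mulA3.
Qed.

(** If [v] were a derivative of a leader of [C0], then so would be [u]. By comparison of orders that
    leader is not [u], against autoreducedness of [C0]. *)
Let component_elt i : gen (C i) u <> None -> exists g v,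
  [/\ g \in C i, leader g = Some v & gen C0 v = None].
Proof.
case E: (gen (C i) u) => [[[e a] g']|//] _.
have [g [v [gC gv vu _ _]]] := genP E; exists g, v; split=> //.
have vh : (ordD v <= h)%N.
  have [v0 _] := (leaderP nu_inj rkE g v).1 gv.
  rewrite leqNgt; apply/negP => hv; have := C_order gC (x := v).
  rewrite /order_le -ltnNge => /(_ hv) E'; move: v0.
  by rewrite -[degv v g]/(pdeg PL v g) E'.
case E0: (gen C0 v) => [[[e0 a0] g0]|//].
have [c2 [u2 [c2C c2u u2v _ _]]] := genP E0.
have uu : u2 != u.
  apply: contraTneq (leq_ltn_trans vh hu) => E2.
  by rewrite -leqNgt; apply: ordD_below; rewrite -E2.
have [Aut0 _ _] := ch0.
have cc2 : c != c2 by apply: contra_neq uu => E2; move: c2u; rewrite -E2 cu => -[].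
have := autoreduced_red Aut0 cC0 c2C cc2.
rewrite (dreducedE _ c2u) => /andP[/allP /(_ _ (leader_vars rkE cu))].
by rewrite proper_derivativeE (below_trans u2v vu) uu.
Qed.

(** Induction on the list of components not yet known to contain [H0 * p]. The induction hypothesis
    serves twice: for [p * g] with [g] in [C i], and then for [p] itself. *)
Let sat_of_components (s : seq 'I_n) : (forall i, i \in s -> gen (C i) u <> None) ->
  forall p, (forall i, i \notin s -> J i (H0 * p)) -> sat H0 I p.
Proof.
have [I0 ID IM _ Irad] := radI; have [Aut0 C0I _] := ch0.
elim: s => [_ p Hp|i s IH Hs p Hp].
  exists 1%N; apply/IE => i; rewrite expr1; exact: Hp.
have {}IH := IH (fun j js => Hs j (mem_behead (s := i :: s) js)).
apply: (IH) => j js; case: (eqVneq j i) => [-> {j js}|ji]; last first.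
  by apply: Hp; rewrite inE negb_or ji.
have [g [v [gC gv G0v]]] := component_elt (Hs i (mem_head _ _)).
have [_ CJ _] := chJ i; have [_ _ JCM _ Jrad] := radJ i.
have pg : sat H0 I (p * g).
  apply: IH => j js; have [_ _ JM _ _] := radJ j.
  case: (eqVneq j i) => [-> |ji]; first exact: JCM _ _ (JCM _ _ (CJ _ gC)).
  have Hpj : J j (H0 * p) by apply: Hp; rewrite inE negb_or ji.
  exact: (@closed_mulAr R (J j) JM H0 p g Hpj).
have [_ gx] := (leaderP nu_inj rkE g v).1 gv.
have JG w e a g' : gen C0 w = Some (e, a, g') -> I g' by apply: gen_closed radI C0I.
have [e Ie] := @sat_pdiff _ _ PL nu nu_inj predT H0 (gen C0) gG0 I I0 ID IM Irad JG red0 p g v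
  G0v gx pg.
have Je : J i (H0 ^+ e * (p * pdiff PL v g)) by move: (i); apply/IE.
have [_ [e' [b [_ E]]]] := @divides_HA k m l rk predT (C i) g (fun c' _ => @supp_predT c') gC.
rewrite (separantE gv) in E.
have Jn := @power_cofactor_cancel R (J i) JCM (HA rk (C i)) e' (pderivv v g) b p (H0 ^+ e) E Je.
(* The separant of [g] has been cancelled, leaving [H0 ^+ e * p] in the component; radicality lowers
   the exponent to 1. *)
apply: (Jrad _ e.+1); apply: (@power_product R (J i) JCM H0 p e).
exact: (@saturate_cancel R (dideal delta (C i)) (HA rk (C i)) e' _ Jn).
Qed.

Lemma large_leader_absurd : False.
Proof.
apply: not_sat1; apply: (@sat_of_components [seq i <- enum 'I_n | gen (C i) u != None]) => i.
  by rewrite mem_filter => /andP[/eqP].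
rewrite mem_filter mem_enum andbT negbK => /eqP /H0_mem.
exact: closed_mulr1.
Qed.

End LargeLeader.

Lemma leader_order c u : c \in C0 -> leader c = Some u -> (ordD u <= h)%N.
Proof.
by move=> cC0 cu; rewrite leqNgt; apply/negP; apply: large_leader_absurd cC0 cu.
Qed.

End Decomposition.

Lemma pdiff_sub_free (T : eqType) (S : comRingType) (PL : poly_like T S) v (s p r : S) :
  pdeg PL v s = 0%N -> pdeg PL v r = 0%N -> pdiff PL v (s * p - r) = s * pdiff PL v p.
Proof. by move=> s0 r0; rewrite pdiffD pdiffN (pdiff_free r0) subr0 pdiff_mul_free. Qed.

(** * Comparison of the characteristic sets *)

Section Comparison.
Variables (k : fieldType) (m l : nat) (delta : 'I_m -> k -> k).
Local Notation T := (Der m l).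
Local Notation R := (DPoly k m l).
Local Notation PL := (dpoly_like k m l).
Variables (rk : rel T) (nu : T -> nat).
Hypotheses (rk_ranking : is_ranking rk) (rk_orderly : is_orderly rk).
Hypotheses (nu_inj : injective nu) (rkE : forall u v, rk u v = (nu u <= nu v)%N).
Local Notation leader := (leader rk).
Local Notation gen := (gen delta rk).
Implicit Types (p q c f g r : R) (u v w x y : T) (t : Theta m) (A : seq R).

Variables (I I' : R -> Prop) (h : nat) (C0 C' : seq R).
Hypotheses (radI : is_radical_dideal delta I) (ch0 : kolchin_charset rk I C0).
Hypothesis consistent : ~ saturate (dideal delta C0) (HA rk C0) 1.
Hypothesis I'E : forall p, I' p <-> I p /\ in_Rh h p.
Hypothesis order0 : forall c u, c \in C0 -> leader c = Some u -> (ordD u <= h)%N.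
Hypothesis ch' : alg_charset rk I' C'.

Let Aut0 : dautoreduced rk C0. Proof. by case: ch0. Qed.
Let Aut' : aautoreduced rk C'. Proof. by case: ch'. Qed.
Let C'I c : c \in C' -> I c /\ in_Rh h c.
Proof. by move=> cC; apply/I'E; case: ch' => _ CI' _; apply: CI'. Qed.

Let supp_predT p : supp_in PL predT p. Proof. by []. Qed.

Let gG0 := @gen_good k m l delta rk nu rk_ranking nu_inj rkE predT C0 (fun c' _ => @supp_predT c').

Let below_h u v : (nu u <= nu v)%N -> (ordD v <= h)%N -> (ordD u <= h)%N.
Proof. by move=> /(nu_ordD rk_ranking rk_orderly rkE); apply: leq_trans. Qed.

Let C'_order c u : c \in C' -> leader c = Some u -> (ordD u <= h)%N.
Proof. by move=> /C'I[_ /allP ch] /(leader_vars rkE) /ch. Qed.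

Let uniq' c c' u : c \in C' -> c' \in C' -> leader c = Some u -> leader c' = Some u -> c = c'.
Proof. exact: (autoreduced_leader (fun f g H => H) Aut'). Qed.

Let elt_gen v := forall c, c \in C' -> leader c = Some v ->
  exists a g, gen C0 v = Some (degv v c, a, g).
Let gen_elt v := forall e a g, gen C0 v = Some (e, a, g) -> (ordD v <= h)%N ->
  exists c, [/\ c \in C', leader c = Some v & degv v c = e].

Section Step.
Variable v : T.
Hypothesis below_v : forall w, (nu w < nu v)%N -> elt_gen w /\ gen_elt w.

(** Otherwise [c] would be reduced with respect to [C0]: below [v] the generators have the degrees
    of elements of [C'], to which [c] is reduced, and above [v] nothing occurs in [c]. *)
Let elt_gen_le c : c \in C' -> leader c = Some v ->
  exists e a g, gen C0 v = Some (e, a, g) /\ (e <= degv v c)%N.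
Proof.
move=> cC cv; have vh := C'_order cC cv.
case: (classic (exists e a g, gen C0 v = Some (e, a, g) /\ (e <= degv v c)%N)) => // no.
have [Ic _] := C'I cC; exfalso.
apply: (kolchin_irreducible rk_ranking nu_inj rkE ch0 Ic (leader_Some_notin_k rkE cv)).
apply: (gen_dreduced (delta := delta) rkE Aut0) => w e a g Gw.
have [_ cx] := (leaderP nu_inj rkE c v).1 cv.
case: (ltngtP (nu w) (nu v)) => [wv|vw|/nu_inj wv].
- have [_ GE] := below_v wv.
  have [c2 [c2C c2w <-]] := GE _ _ _ Gw (below_h (ltnW wv) vh).
  have ne : c != c2.
    apply: contraTneq wv => E; move: cv; rewrite E c2w => -[->].
    by rewrite ltnn.
  by have := autoreduced_red Aut' cC c2C ne; rewrite (areducedE _ c2w).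
- have [e0 _ _ _ _] := gG0 Gw; by rewrite cx.
- rewrite wv in Gw *; rewrite ltnNge; apply/negP => ec.
  by apply: no; exists e, a, g.
Qed.

(** The generator [g] is reduced by those below [v]. The remainder [r] lies in [I'] and still has
    leader [v], so it is not reduced with respect to some element of [C']. *)
Let gen_elt_le e a g : gen C0 v = Some (e, a, g) -> (ordD v <= h)%N ->
  exists c, [/\ c \in C', leader c = Some v & (degv v c <= e)%N].
Proof.
move=> Gv vh; have [I0 ID IM _ _] := radI; have [_ C0I _] := ch0.
have IG w e' a' g' : gen C0 w = Some (e', a', g') -> I g' by apply: gen_closed radI C0I.
have [e0 [q gE qe] [a0 gx] _ [n [b [_ HE]]]] := gG0 Gv.
have [s [r [[Hs _] sx sp rw [_ rx]]]] := pseudo_reduction nu_inj (nu v) gG0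
  (fun _ _ _ _ => isT) (@supp_predT g).
have Isp : I (s * g - r).
  apply: (idl_sub I0 ID IM _ sp) => g' [w [e' [a' [_ _]]]]; exact: IG.
have Ir : I r := @ideal_sub R I (s * g) r ID IM (IM s g (IG _ _ _ _ Gv)) Isp.
have rfree x : (nu v < nu x)%N -> degv x r = 0%N.
  move=> vx; apply/eqP; rewrite -leqn0; apply: leq_trans (rx x (ltnW vx)) _.
  by have [_ ->] := gx _ vx.
have gv : (pdeg PL v g <= e)%N.
  rewrite gE; apply: pdegD; last exact: ltnW.
  rewrite -[e in (_ <= e)%N]add0n; apply: pdegM_le; first by rewrite a0.
  by rewrite -[e in (_ <= e)%N]muln1; apply: pdegX_le; rewrite pdeg_var eqxx.
have re : (degv v r <= e)%N := leq_trans (rx v (leqnn _)) gv.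
(* Were [r] free of [v], differentiating with respect to [v] would put a multiple of the separant of
   [g] into the differential ideal of [C0], and the saturation would contain 1. *)
have rv : (0 < degv v r)%N.
  rewrite lt0n; apply/eqP => r0; apply: consistent.
  have gfree g' : gens nu (gen C0) predT (nu v) g' -> pdeg PL v g' = 0%N.
    move=> [w [e' [a' [wv _ Gw]]]].
    by have [_ _ [_ gx'] _ _] := gG0 Gw; have [] := gx' v wv.
  have := idl_dideal (idl_pdiff gfree sp).
  rewrite (@pdiff_sub_free _ _ PL v s g r (sx v (leqnn _)) r0) => D.
  have [n' [b' [_ HE']]] := Hs.
  have D1 := @power_cofactor R _ (@didealM _ _ _ delta C0) _ _ _ _ _ HE' D.
  exists (n' + n)%N.
  exact: (@power_cofactor2 R _ (@didealM _ _ _ delta C0) _ _ _ _ _ HE D1).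
have rl : leader r = Some v by apply/(leaderP nu_inj rkE).
have rR : in_Rh h r.
  apply/allP => x xr; have := leader_spec rkE r; rewrite rl => -[_ /(_ x xr) xv].
  exact: below_h xv vh.
have I'r : I' r by apply/I'E.
have /allPn[c cC Hc] : ~~ all (areduced rk r) C'.
  apply/negP => /allP H.
  exact: (alg_irreducible nu_inj rkE ch' I'r (leader_Some_notin_k rkE rl) H).
have [x cx] := leader_notin_k rkE (autoreduced_notin_k Aut' cC).
move: Hc; rewrite (areducedE _ cx) -leqNgt => cr.
have [c0 _] := (leaderP nu_inj rkE c x).1 cx.
(* A leader below [v] is impossible: it carries a generator of the same degree, to which [r] is
   already reduced. *)
case: (ltngtP (nu x) (nu v)) => [xv|/rfree E|/nu_inj E].
- have [EG _] := below_v xv; have [a' [g' Gx]] := EG _ cC cx.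
  by have := leq_ltn_trans cr (rw _ _ _ _ xv Gx); rewrite ltnn.
- by move: c0 cr; rewrite E leqn0 lt0n => /negbTE ->.
exists c; split=> //; first by rewrite cx E.
by rewrite -E in re *; apply: leq_trans cr re.
Qed.

Lemma compare_step : elt_gen v /\ gen_elt v.
Proof.
split=> [c cC cv|e a g Gv vh].
  have [e [a [g [Gv ec]]]] := elt_gen_le cC cv.
  have [c2 [c2C c2v c2e]] := gen_elt_le Gv (C'_order cC cv).
  have E := uniq' cC c2C cv c2v; exists a, g.
  by rewrite Gv; congr (Some (_, _, _)); apply/eqP; rewrite eqn_leq ec E c2e.
have [c [cC cv ce]] := gen_elt_le Gv vh; exists c; split=> //.
have [e' [a' [g' [Gv' ec]]]] := elt_gen_le cC cv.
move: Gv'; rewrite Gv => -[E _ _]; rewrite -E in ec.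
by apply/eqP; rewrite eqn_leq ce ec.
Qed.

End Step.

Lemma compare_gens v : elt_gen v /\ gen_elt v.
Proof.
have [N] := ubnP (nu v); elim: N v => // N IH v; rewrite ltnS => vN.
by apply: compare_step => w wv; apply: IH; apply: leq_trans wv vN.
Qed.

Let D := [seq c <- C' | has (fun c0 => leader c0 == leader c) C0].

Let memD c : c \in D -> exists c0 u,
  [/\ c \in C', c0 \in C0, leader c = Some u, leader c0 = Some u & degv u c = degv u c0].
Proof.
rewrite mem_filter => /andP[/hasP[c0 c0C /eqP cc] cC].
have [u c0u] := leader_notin_k rkE (autoreduced_notin_k Aut0 c0C).
have cu : leader c = Some u by rewrite -cc.
exists c0, u; split=> //.
have [/(_ c cC cu)[a [g Gu]] _] := compare_gens u.
by have [a' [g']] := gen_exact delta rkE Aut0 c0C c0u; rewrite Gu => -[].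
Qed.

Let D_elt c0 u : c0 \in C0 -> leader c0 = Some u ->
  exists c, [/\ c \in D, leader c = Some u & degv u c = degv u c0].
Proof.
move=> c0C c0u; have [a [g Gu]] := gen_exact delta rkE Aut0 c0C c0u.
have [_ GE] := compare_gens u.
have [c [cC cu cd]] := GE _ _ _ Gu (order0 c0C c0u).
exists c; split=> //; rewrite mem_filter cC andbT.
by apply/hasP; exists c0 => //; rewrite c0u cu.
Qed.

(** A proper derivative [w] of a leader, of order at most [h], carries a linear generator, hence a
    degree-one element of [C']. Algebraic reducedness with respect to that element forbids [w]. *)
Let Aut_D : dautoreduced rk D.
Proof.
have [A' S' _] := Aut'; apply: (autoreducedI nu_inj rkE).
- by apply/allP => c; rewrite mem_filter => /andP[_ /(allP A')].
- exact: (sorted_filter (rank_lt_trans nu_inj rkE)).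
move=> c c2 cD c2D ne.
have [c0 [u [cC c0C cu c0u cd]]] := memD cD.
have [c02 [u2 [c2C c02C c2u c02u c2d]]] := memD c2D.
have := autoreduced_red Aut' cC c2C ne.
rewrite (areducedE _ c2u) (dreducedE _ c2u) => ->; rewrite andbT.
apply/allP => w wc; apply/negP => uw.
have [a [g Gw]] := gen_proper delta rkE Aut0 c02C c02u uw.
have [_ /allP ch] := C'I cC; have wh := ch w wc.
have [EG GE] := compare_gens w.
have [c3 [c3C c3w c3d]] := GE _ _ _ Gw wh.
have cc3 : c != c3.
  apply/eqP => E; move: c3w; rewrite -E cu => -[E2]; rewrite -E2 in uw.
  have cc : c0 != c02.
    apply: contraTneq uw => E3; move: c0u; rewrite E3 c02u => -[->].
    by rewrite proper_derivativeE eqxx andbF.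
  have := autoreduced_red Aut0 c0C c02C cc.
  by rewrite (dreducedE _ c02u) => /andP[/allP /(_ _ (leader_vars rkE c0u))]; rewrite uw.
have := autoreduced_red Aut' cC c3C cc3; rewrite (areducedE _ c3w) c3d ltnS leqn0.
by move: wc; rewrite mem_vars => /negbTE ->.
Qed.

(** Both lists of ranks are strictly increasing and have the same members. *)
Let rkey_D : map (rkey rk nu) D = map (rkey rk nu) C0.
Proof.
have [D0 DS _] := Aut_D; have [A0 AS _] := Aut0.
apply: (irr_sorted_eq lexlt_trans lexlt_irr).
- exact: (sorted_rkey nu_inj rkE D0 DS).
- exact: (sorted_rkey nu_inj rkE A0 AS).
move=> key; apply/mapP/mapP => [[c cD ->]|[c0 c0C ->]].
  have [c0 [u [_ c0C cu c0u cd]]] := memD cD; exists c0 => //.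
  by rewrite /rkey cu c0u cd.
have [u c0u] := leader_notin_k rkE (autoreduced_notin_k Aut0 c0C).
have [c [cD cu cd]] := D_elt c0C c0u; exists c => //.
by rewrite /rkey cu c0u cd.
Qed.

Let chD : kolchin_charset rk I D.
Proof.
have [D0 _ _] := Aut_D; have [A0 _ _] := Aut0; have [_ _ min0] := ch0.
split=> // [c /memD[_ [_ [/C'I[]]]] //|B Baut BI].
have [B0 _ _] := Baut.
by rewrite (eq_aut_lt nu_inj rkE D0 A0 B0 rkey_D); apply: min0.
Qed.

(** [D] is a characteristic set of [I] contained in [C']. A lowest subset [B] is not above [D], so a
    set lower than [B] would be lower than [D]. *)
Lemma lowest_subset_is_charset :
  (exists B, lowest_dautoreduced_subset rk C' B) /\
  (forall B, lowest_dautoreduced_subset rk C' B -> kolchin_charset rk I B).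
Proof.
have [_ DI minD] := chD; have [D0 _ _] := Aut_D.
have subI B : {subset B <= C'} -> Defs.subsetP B I by move=> BC c /BC /C'I[].
have DC : {subset D <= C'} by move=> c; rewrite mem_filter => /andP[].
split=> [|B [Baut BC Bmin]].
  by exists D; split=> // B Baut /subI; apply: minD.
split=> // [|B2 B2aut B2I]; first exact: subI.
have [B0 _ _] := Baut; have [B20 _ _] := B2aut.
apply/negP => lt; have := aut_lt_cotrans nu_inj rkE B20 D0 B0 lt.
by rewrite (negbTE (minD _ B2aut B2I)) (negbTE (Bmin _ Aut_D DC)).
Qed.

End Comparison.

Theorem mainTheorem6 (k : fieldType) (m l : nat) (delta : 'I_m -> k -> k)
  (rk : rel (Der m l)) (I : DPoly k m l -> Prop)
  (n : nat) (C : 'I_n -> seq (DPoly k m l)) (C' : seq (DPoly k m l)) :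
  diff_field_char0 delta ->
  is_ranking rk -> is_orderly rk ->
  is_radical_dideal delta I ->
  (exists C0 : seq (DPoly k m l),
     kolchin_charset rk I C0 /\
     ~ saturate (dideal delta C0) (HA rk C0) 1) ->
  char_decomposition delta rk I C ->
  alg_charset rk (Iprime delta rk (max_order C) C) C' ->
  (exists B, lowest_dautoreduced_subset rk C' B) /\
  (forall B, lowest_dautoreduced_subset rk C' B -> kolchin_charset rk I B).
Proof.
move=> _ rk_ranking rk_orderly radI [C0 [ch0 consistent]] decI ch'.
have [nu [nu_inj rkE]] := orderly_index rk_ranking rk_orderly.
(* What remains is that I' is the intersection of [I] with R_h, and the bound on the orders of the
   leaders of [C0]. *)
refine (lowest_subset_is_charset (h := max_order C) rk_ranking rk_orderly nu_inj rkE radI ch0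
  consistent _ _ ch').
  move=> p; split=> [Ip|[Ip ph]].
    by split; [exact: (Iprime_sub decI Ip) | have [] := Ip].
  exact: (sub_Iprime rk_ranking rk_orderly nu_inj rkE decI Ip ph).
exact: (leader_order rk_ranking nu_inj rkE radI ch0 consistent decI).
Qed.
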